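(* Let $(x_i,r_i)_{i\in\mathcal{I}}$ be a homogeneous ubiquitous system in a nonempty open set $U\subseteq\mathbb{R}^d$. Then for every real $t>1$, the set $F_t\cap U$ has positive Hausdorff $g$-measure for the gauge function $g(r)=r^{d/t}|\log r|$; in particular $\dim_{\mathrm{H}}(F_t\cap U)\ge d/t$.
   Context: Fix a norm $|\cdot|$ on $\mathbb{R}^d$; $\mathcal{L}^d$ is Lebesgue measure. Let $\mathcal{I}$ be a countably infinite index set. A family $(x_i,r_i)_{i\in\mathcal{I}}$ in $\mathbb{R}^d\times(0,\infty)$ is an approximation system if $\sup_i r_i<\infty$ and for every $m\in\mathbb{N}$ the set $\{i\in\mathcal{I}: |x_i|<m,\ r_i>1/m\}$ is finite. For $t\ge1$, $F_t=\{x\in\mathbb{R}^d: |x-x_i|<r_i^t \text{ for infinitely many } i\in\mathcal{I}\}$. The approximation system is a homogeneous ubiquitous system in a nonempty open set $U$ if $F_1$ has full Lebesgue measure in $U$, i.e. $\mathcal{L}^d(U\setminus F_1)=0$. The Hausdorff $g$-measure is $\mathcal{H}^g(E)=\lim_{\delta\downarrow0}\inf\{\sum_n g(\mathrm{diam}\,C_n):E\subseteq\bigcup_nC_n,\ \mathrm{diam}\,C_n\le\delta\}$. *)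

(* Defs.v *)
From Stdlib Require Fin.
From Stdlib Require Import Reals Lra List Arith.
Open Scope R_scope.

Definition Rd (d : nat) : Type := Fin.t d -> R.

Definition vsub {d} (x y : Rd d) : Rd d := fun i => x i - y i.
Definition vadd {d} (x y : Rd d) : Rd d := fun i => x i + y i.
Definition vscal {d} (c : R) (x : Rd d) : Rd d := fun i => c * x i.

Definition is_norm {d} (N : Rd d -> R) : Prop :=
  (forall x, 0 <= N x) /\
  (forall x, N x = 0 -> forall i, x i = 0) /\
  (forall c x, N (vscal c x) = Rabs c * N x) /\
  (forall x y, N (vadd x y) <= N x + N y).

Definition is_open {d} (U : Rd d -> Prop) : Prop :=
  forall x, U x -> exists eps, 0 < eps /\
    forall y, (forall i, Rabs (y i - x i) < eps) -> U y.

Definition coord {d} (x : Rd d) (i : nat) : R :=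
  match Compare_dec.lt_dec i d with
  | left h => x (Fin.of_nat_lt h)
  | right _ => 0
  end.

Definition box_vol {d} (a b : Rd d) : R :=
  fold_right Rmult 1 (map (fun i => coord b i - coord a i) (seq 0 d)).

Definition lebesgue_null {d} (E : Rd d -> Prop) : Prop :=
  forall eps, 0 < eps -> exists a b : nat -> Rd d,
    (forall n i, a n i <= b n i) /\
    (forall x, E x -> exists n, forall i, a n i <= x i <= b n i) /\
    (forall M, sum_f_R0 (fun n => box_vol (a n) (b n)) M <= eps).

Definition finite_set {I : Type} (P : I -> Prop) : Prop :=
  exists l : list I, forall i, P i -> In i l.
Definition infinite_set {I : Type} (P : I -> Prop) : Prop := ~ finite_set P.

Definition countably_infinite (I : Type) : Prop :=
  exists f : nat -> I, (forall a b, f a = f b -> a = b) /\ (forall i, exists n, f n = i).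

Definition approx_system {d} {I : Type} (N : Rd d -> R) (x : I -> Rd d) (r : I -> R) : Prop :=
  (forall i, 0 < r i) /\
  (exists M, forall i, r i <= M) /\
  (forall m : nat, finite_set (fun i => N (x i) < INR m /\ r i > 1 / INR m)).

Definition F_t {d} {I : Type} (N : Rd d -> R) (x : I -> Rd d) (r : I -> R) (t : R)
  (y : Rd d) : Prop :=
  infinite_set (fun i => N (vsub y (x i)) < Rpower (r i) t).

Definition homogeneous_ubiquitous {d} {I : Type} (N : Rd d -> R) (x : I -> Rd d)
  (r : I -> R) (U : Rd d -> Prop) : Prop :=
  approx_system N x r /\ (exists y, U y) /\ is_open U /\
  lebesgue_null (fun y => U y /\ ~ F_t N x r 1 y).

(** D is the diameter (w.r.t. N) of the set C; the empty set has diameter 0. *)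
Definition is_diam {d} (N : Rd d -> R) (C : Rd d -> Prop) (D : R) : Prop :=
  0 <= D /\
  (forall y z, C y -> C z -> N (vsub y z) <= D) /\
  (forall D', 0 <= D' -> (forall y z, C y -> C z -> N (vsub y z) <= D') -> D <= D').

Definition series_ge (u : nat -> R) (c : R) : Prop :=
  forall eps, 0 < eps -> exists M, sum_f_R0 u M > c - eps.

(** H^g(E) > 0.  Since H^g = lim_{delta->0} H^g_delta with H^g_delta nondecreasing as
    delta decreases, H^g(E) > 0 iff H^g_delta(E) >= c for some delta > 0, c > 0. *)
Definition hausdorff_pos {d} (N : Rd d -> R) (g : R -> R) (E : Rd d -> Prop) : Prop :=
  exists delta c, 0 < delta /\ 0 < c /\
    forall (C : nat -> Rd d -> Prop) (D : nat -> R),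
      (forall y, E y -> exists n, C n y) ->
      (forall n, is_diam N (C n) (D n) /\ D n <= delta) ->
      series_ge (fun n => g (D n)) c.

Definition gauge_log (d : nat) (t : R) (r : R) : R :=
  if Rle_dec r 0 then 0 else Rpower r (INR d / t) * Rabs (ln r).

Definition gauge_pow (s : R) (r : R) : R :=
  if Rle_dec r 0 then 0 else Rpower r s.

(* Main.v *)
(** The mass transference argument for this gauge. Given a ball of radius rho and mass m inside
    [U], compactness and Vitali's argument produce finitely many separated balls B(x_i, r_i) in it,
    of arbitrarily small radii and of total volume at least kappa rho^d; the mass m is shared among
    the balls B(x_i, r_i^t / 2) proportionally to r_i^d. Each of them gets mass of order
    r_i^d m / rho^d, at most g(r_i^t / 2) when r_i is small, thanks to the logarithm. A set of
    diameter D meeting at least two of them has D >= r_i / 2 for each of these, hence meets a mass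
    at most of order m (D / rho)^d, which is at most a constant times g(D) since g(r) / r^d is
    decreasing. So if a cover has a total g-cost below a constant times the mass of the starting
    ball, a pigeonhole over the subdivision preserves this property for one of the small balls,
    and iterating yields a point of F_t that no set of the cover contains. *)

Require Import Defs.
From Stdlib Require Import Reals Lra Lia List Arith.
From Stdlib Require Import Classical ClassicalEpsilon FunctionalExtensionality.
From Coquelicot Require Import Coquelicot.
Open Scope R_scope.

(** * Volumes of boxes *)

(** No limit measure is built: at each stage the mass is only a number, compared with the cost still
    to be paid, namely the sum of [K * gauge_log d t (D n)] over the cover sets meeting the current
    ball. The pigeonhole is applied to costs truncated at the mass of each small ball. A set meeting
    one small ball hands it at most its own cost, and a set meeting several hands them at most their
    masses, so the truncated costs never add up to more than the cost itself. In the selected ball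
    the truncated total is below the mass, hence so is every term, and the truncation has no effect
    there. The density [m / rho ^ d] is not bounded along the construction, since every ball is
    shrunk before it is subdivided again. The radii of the next stage are therefore chosen after
    this density is known, small enough for the logarithm to absorb it. Lebesgue measure enters only
    through covers of a null set by boxes; after compactness, finitely many volumes remain to be
    compared, and this is done by counting lattice points. *)

Definition lsum {A : Type} (f : A -> R) (l : list A) : R :=
  fold_right (fun a s => f a + s) 0 l.

Lemma lsum_le {A} (f g : A -> R) l :
  (forall a, In a l -> f a <= g a) -> lsum f l <= lsum g l.
Proof.
  induction l as [|a l IH]; simpl; intros H; [lra|].
  apply Rplus_le_compat; [apply H; now left | apply IH; intros; apply H; now right].
Qed.

Lemma lsum_nonneg {A} (f : A -> R) l :
  (forall a, In a l -> 0 <= f a) -> 0 <= lsum f l.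
Proof.
  induction l as [|a l IH]; simpl; intros H; [lra|].
  apply Rplus_le_le_0_compat; [apply H; now left | apply IH; intros; apply H; now right].
Qed.

Lemma lsum_scal {A} c (f : A -> R) l : lsum (fun a => c * f a) l = c * lsum f l.
Proof. induction l as [|a l IH]; simpl; [ring | rewrite IH; ring]. Qed.

Lemma lsum_app {A} (f : A -> R) l1 l2 : lsum f (l1 ++ l2) = lsum f l1 + lsum f l2.
Proof. induction l1 as [|a l IH]; simpl; [ring | rewrite IH; ring]. Qed.

Lemma lsum_map {A B} (h : A -> B) (f : B -> R) l :
  lsum f (map h l) = lsum (fun a => f (h a)) l.
Proof. induction l as [|a l IH]; simpl; [easy | now rewrite IH]. Qed.

Fixpoint rprod (d : nat) (f : nat -> R) : R :=
  match d with O => 1 | S d' => rprod d' f * f d' end.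

Lemma rprod_ext d f g : (forall i, (i < d)%nat -> f i = g i) -> rprod d f = rprod d g.
Proof.
  induction d as [|d IH]; simpl; intros H; [easy|].
  rewrite IH by (intros; apply H; lia). now rewrite H by lia.
Qed.

Lemma rprod_nonneg d f : (forall i, (i < d)%nat -> 0 <= f i) -> 0 <= rprod d f.
Proof.
  induction d as [|d IH]; simpl; intros H; [lra|].
  apply Rmult_le_pos; [apply IH; intros|]; apply H; lia.
Qed.

Lemma rprod_le d f g :
  (forall i, (i < d)%nat -> 0 <= f i <= g i) -> rprod d f <= rprod d g.
Proof.
  induction d as [|d IH]; simpl; intros H; [lra|].
  apply Rmult_le_compat.
  - apply rprod_nonneg; intros; apply H; lia.
  - apply H; lia.
  - apply IH; intros; apply H; lia.
  - apply H; lia.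
Qed.

Lemma rprod_const d c : rprod d (fun _ => c) = c ^ d.
Proof. induction d as [|d IH]; simpl; [easy | rewrite IH; ring]. Qed.

Lemma rprod_lim d (f : nat -> nat -> R) (g : nat -> R) :
  (forall i, (i < d)%nat -> is_lim_seq (fun n => f n i) (g i)) ->
  is_lim_seq (fun n => rprod d (f n)) (rprod d g).
Proof.
  induction d as [|d IH]; simpl; intros H; [apply is_lim_seq_const|].
  apply is_lim_seq_mult'; [apply IH; intros|]; apply H; lia.
Qed.

Lemma lsum_lim {A} (f : nat -> A -> R) (g : A -> R) l :
  (forall a, In a l -> is_lim_seq (fun n => f n a) (g a)) ->
  is_lim_seq (fun n => lsum (f n) l) (lsum g l).
Proof.
  induction l as [|a l IH]; simpl; intros H; [apply is_lim_seq_const|].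
  apply is_lim_seq_plus'; [apply H; now left | apply IH; intros; apply H; now right].
Qed.

(** * Lattice point counts in a cube *)

Definition mesh (T : R) (n : nat) : R := 2 * T / INR (S n).

(** A left Riemann sum on [[- T, T]], with [n + 1] nodes from [- T] to [T - mesh T n]. *)
Definition grid_sum (T : R) (n : nat) (f : R -> R) : R :=
  mesh T n * sum_f_R0 (fun k => f (- T + INR k * mesh T n)) n.

(** The iterated Riemann sum over [[- T, T] ^ d], with all coordinates from [d] on set to 0. It
    stands in for the integral: it is monotone, additive, and multiplicative on products of
    functions of one coordinate. *)
Fixpoint lattice_sum (T : R) (n d : nat) (F : (nat -> R) -> R) : R :=
  match d with
  | O => F (fun _ => 0)
  | S d' => grid_sum T n (fun u =>
      lattice_sum T n d' (fun p => F (fun i => if Nat.eqb i d' then u else p i)))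
  end.

Lemma mesh_pos T n : 0 < T -> 0 < mesh T n.
Proof. intros H. apply Rdiv_lt_0_compat; [lra | apply lt_0_INR; lia]. Qed.

Lemma mesh_lim T : is_lim_seq (mesh T) 0.
Proof.
  unfold mesh, Rdiv. replace (Finite 0) with (Rbar_mult (2 * T) 0) by (simpl; f_equal; ring).
  apply is_lim_seq_scal_l.
  replace (Finite 0) with (Rbar_inv p_infty) by reflexivity.
  apply is_lim_seq_inv; [|easy].
  apply -> is_lim_seq_incr_1. apply is_lim_seq_INR.
Qed.

Lemma grid_sum_le T n f g : 0 < T -> (forall u, f u <= g u) -> grid_sum T n f <= grid_sum T n g.
Proof.
  intros HT H. apply Rmult_le_compat_l; [left; now apply mesh_pos|].
  apply sum_Rle. intros; apply H.
Qed.

Lemma grid_sum_plus T n f g :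
  grid_sum T n (fun u => f u + g u) = grid_sum T n f + grid_sum T n g.
Proof. unfold grid_sum. rewrite sum_plus. ring. Qed.

Lemma grid_sum_scal T n f c : grid_sum T n (fun u => f u * c) = grid_sum T n f * c.
Proof. unfold grid_sum. rewrite <- scal_sum. ring. Qed.

Lemma lattice_sum_le T n d F G :
  0 < T -> (forall p, F p <= G p) -> lattice_sum T n d F <= lattice_sum T n d G.
Proof.
  intros HT. revert F G. induction d as [|d IH]; simpl; intros F G H; [apply H|].
  apply grid_sum_le; [easy|]. intros u. apply IH. intros; apply H.
Qed.

Lemma grid_sum_ext T n f g : (forall u, f u = g u) -> grid_sum T n f = grid_sum T n g.
Proof. intros H. f_equal. now apply functional_extensionality. Qed.

Lemma lattice_sum_ext T n d F G :
  (forall p, F p = G p) -> lattice_sum T n d F = lattice_sum T n d G.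
Proof. intros H. f_equal. now apply functional_extensionality. Qed.

Lemma lattice_sum_plus T n d F G :
  lattice_sum T n d (fun p => F p + G p) = lattice_sum T n d F + lattice_sum T n d G.
Proof.
  revert F G. induction d as [|d IH]; simpl; intros F G; [easy|].
  rewrite <- grid_sum_plus. apply grid_sum_ext. intros u. apply IH.
Qed.

Lemma lattice_sum_scal T n d F c :
  lattice_sum T n d (fun p => F p * c) = lattice_sum T n d F * c.
Proof.
  revert F. induction d as [|d IH]; simpl; intros F; [easy|].
  rewrite <- grid_sum_scal. apply grid_sum_ext. intros u. apply IH.
Qed.

Lemma lattice_sum_lsum {A} T n d (F : A -> (nat -> R) -> R) l :
  lattice_sum T n d (fun p => lsum (fun a => F a p) l)
  = lsum (fun a => lattice_sum T n d (F a)) l.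
Proof.
  induction l as [|a l IH]; simpl.
  - rewrite (lattice_sum_ext _ _ _ _ (fun p => 0 * 0)) by (intros; ring).
    rewrite (lattice_sum_scal T n d (fun _ => 0) 0). ring.
  - rewrite lattice_sum_plus. now rewrite IH.
Qed.

Lemma lattice_sum_prod T n d (f : nat -> R -> R) :
  lattice_sum T n d (fun p => rprod d (fun i => f i (p i)))
  = rprod d (fun i => grid_sum T n (f i)).
Proof.
  induction d as [|d IH]; [easy|].
  cbn [lattice_sum rprod]. rewrite <- IH.
  rewrite Rmult_comm, <- grid_sum_scal. apply grid_sum_ext. intros u.
  rewrite Rmult_comm, <- lattice_sum_scal. apply lattice_sum_ext. intros p.
  rewrite Nat.eqb_refl. f_equal. apply rprod_ext. intros i Hi.
  now rewrite (proj2 (Nat.eqb_neq i d)) by lia.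
Qed.

(** Splits only on comparisons whose arguments contain no further [Rle_dec], so that nested [Rmin]
    and [Rmax] are resolved from the inside out. *)
Ltac split_Rle :=
  repeat match goal with
  | |- context [Rle_dec ?x ?y] =>
      lazymatch constr:((x, y)) with
      | context [Rle_dec _ _] => fail
      | _ => destruct (Rle_dec x y)
      end
  end.

Definition ind1 (a b u : R) : R :=
  if Rle_dec a u then if Rle_dec u b then 1 else 0 else 0.

(** [psi] acts as a discrete antiderivative of [f]. Taking clamping functions for [psi] counts the
    nodes in an interval up to one mesh width. *)
Lemma telescope_le (s h : R) (f psi : R -> R) n :
  (forall u, h * f u <= psi (u + h) - psi u) ->
  h * sum_f_R0 (fun k => f (s + INR k * h)) n <= psi (s + INR (S n) * h) - psi s.
Proof.
  intros H. induction n as [|n IH].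
  - simpl. replace (s + 0 * h) with s by ring. replace (s + 1 * h) with (s + h) by ring.
    apply H.
  - cbn [sum_f_R0]. rewrite (S_INR (S n)).
    specialize (H (s + INR (S n) * h)).
    replace (s + (INR (S n) + 1) * h) with (s + INR (S n) * h + h) by ring. lra.
Qed.

Lemma telescope_ge (s h : R) (f psi : R -> R) n :
  (forall u, psi (u + h) - psi u <= h * f u) ->
  psi (s + INR (S n) * h) - psi s <= h * sum_f_R0 (fun k => f (s + INR k * h)) n.
Proof.
  intros H.
  pose proof (telescope_le s h (fun u => - f u) (fun u => - psi u) n) as H'.
  cbv beta in H'.
  assert (E : sum_f_R0 (fun k => - f (s + INR k * h)) n
              = - sum_f_R0 (fun k => f (s + INR k * h)) n).
  { clear. induction n; simpl in *; lra. }
  rewrite E in H'. cut (forall u, h * - f u <= - psi (u + h) - - psi u); [intros H2; specialize (H' H2); lra|].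
  intros u; specialize (H u); lra.
Qed.

Lemma mesh_end T n : - T + INR (S n) * mesh T n = T.
Proof. unfold mesh. field. apply not_0_INR. lia. Qed.

(* Telescoping of [u |-> clamp u to [a, b + h]], which grows by [h] over each grid point of [a, b]. *)
Lemma grid_sum_ind1_le T n a b :
  0 < T -> a <= b -> grid_sum T n (ind1 a b) <= b - a + mesh T n.
Proof.
  intros HT Hab. pose proof (mesh_pos T n HT) as Hh. unfold grid_sum.
  set (h := mesh T n) in *.
  eapply Rle_trans; [apply (telescope_le (- T) h (ind1 a b) (fun u => Rmin (Rmax u a) (b + h)))|].
  - intros u. unfold ind1, Rmin, Rmax.
    split_Rle; lra.
  - unfold Rmin, Rmax.
    split_Rle; lra.
Qed.

(** The telescoping function now clamps to [[a + h, b]]: between [u] and [u + h] it can grow only if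
    [u] is in [[a, b]]. This needs [a + h <= b]; otherwise the claimed bound is just 0. *)
Lemma grid_sum_ind1_ge T n a b :
  0 < T -> - T <= a -> a <= b -> b <= T ->
  Rmax 0 (b - a - mesh T n) <= grid_sum T n (ind1 a b).
Proof.
  intros HT Ha Hab Hb. pose proof (mesh_pos T n HT) as Hh.
  pose proof (mesh_end T n) as He. unfold grid_sum.
  set (h := mesh T n) in *.
  apply Rmax_lub.
  { apply Rmult_le_pos; [lra|]. apply cond_pos_sum. intros k. unfold ind1.
    split_Rle; lra. }
  destruct (Rle_dec (a + h) b) as [Hc|Hc].
  2:{ eapply Rle_trans with 0; [lra|].
    apply Rmult_le_pos; [lra|]. apply cond_pos_sum. intros k. unfold ind1.
    split_Rle; lra. }
  eapply Rle_trans; [|apply (telescope_ge (- T) h (ind1 a b) (fun u => Rmin (Rmax u (a + h)) b))].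
  - rewrite He. unfold Rmin, Rmax.
    split_Rle; lra.
  - intros u. unfold ind1, Rmin, Rmax.
    split_Rle; lra.
Qed.

(** Corners are indexed by [nat], and only the first [d] coordinates count, so that inductions on
    the dimension avoid [Fin.t]. *)
Definition nbox : Type := ((nat -> R) * (nat -> R))%type.

Definition in_nbox (d : nat) (B : nbox) (p : nat -> R) : Prop :=
  forall i, (i < d)%nat -> fst B i <= p i <= snd B i.

Definition proper_nbox (d : nat) (B : nbox) : Prop :=
  forall i, (i < d)%nat -> fst B i <= snd B i.

Definition vol (d : nat) (B : nbox) : R := rprod d (fun i => snd B i - fst B i).

Definition ind_nbox (d : nat) (B : nbox) (p : nat -> R) : R :=
  rprod d (fun i => ind1 (fst B i) (snd B i) (p i)).

Lemma ind_nbox_in d B p : in_nbox d B p -> ind_nbox d B p = 1.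
Proof.
  intros H. unfold ind_nbox. rewrite (rprod_ext d _ (fun _ => 1)).
  - rewrite rprod_const. apply pow1.
  - intros i Hi. specialize (H i Hi). unfold ind1.
    destruct Rle_dec; [|lra]. destruct Rle_dec; lra.
Qed.

Lemma ind_nbox_notin d B p : ~ in_nbox d B p -> ind_nbox d B p = 0.
Proof.
  unfold ind_nbox, in_nbox. intros H. induction d as [|d IH].
  - exfalso. apply H. intros; lia.
  - simpl. destruct (classic (fst B d <= p d <= snd B d)) as [H1|H1].
    + rewrite IH; [ring|]. intros H2. apply H. intros i Hi.
      destruct (Nat.eq_dec i d) as [->|]; [easy|]. apply H2. lia.
    + replace (ind1 (fst B d) (snd B d) (p d)) with 0; [ring|].
      unfold ind1. destruct Rle_dec; [|easy]. destruct Rle_dec; [|easy]. tauto.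
Qed.

Lemma nboxes_bounded d (L : list nbox) :
  exists T, 0 < T /\ forall B, In B L -> forall i, (i < d)%nat ->
    Rabs (fst B i) <= T /\ Rabs (snd B i) <= T.
Proof.
  assert (H1 : forall f : nat -> R, exists T, 0 < T /\ forall i, (i < d)%nat -> Rabs (f i) <= T).
  { intros f. induction d as [|d [T [HT H]]].
    - exists 1. split; [lra|]. intros; lia.
    - exists (Rmax T (Rabs (f d))). split; [eapply Rlt_le_trans; [apply HT|apply Rmax_l]|].
      intros i Hi. destruct (Nat.eq_dec i d) as [->|]; [apply Rmax_r|].
      eapply Rle_trans; [apply H; lia | apply Rmax_l]. }
  induction L as [|B L [T [HT H]]].
  - exists 1. split; [lra|]. now intros.
  - destruct (H1 (fst B)) as [T1 [HT1 H2]]. destruct (H1 (snd B)) as [T2 [HT2 H3]].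
    exists (T + T1 + T2). split; [lra|]. intros B' [<-|HB] i Hi.
    + specialize (H2 i Hi). specialize (H3 i Hi). lra.
    + specialize (H B' HB i Hi). lra.
Qed.

(* Volumes are limits of normalised lattice point counts, so inequalities between sums of
   indicators of boxes pass to volumes. *)
Lemma vol_le_of_ind_le d (L L' : list nbox) :
  (forall B, In B L -> proper_nbox d B) -> (forall B, In B L' -> proper_nbox d B) ->
  (forall p, lsum (fun B => ind_nbox d B p) L <= lsum (fun B => ind_nbox d B p) L') ->
  lsum (vol d) L <= lsum (vol d) L'.
Proof.
  intros HL HL' H.
  (* Only the boxes of [L] must lie in the cube: the upper bound on a count also holds for boxes
     that stick out. In the lower bound, [Rmax 0] keeps the factors nonnegative, so that they can be
     multiplied. *)
  destruct (nboxes_bounded d L) as [T [HT HB]].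
  assert (K : forall n,
    lsum (fun B => rprod d (fun i => Rmax 0 (snd B i - fst B i - mesh T n))) L
    <= lsum (fun B => rprod d (fun i => snd B i - fst B i + mesh T n)) L').
  { intros n. apply Rle_trans with (lattice_sum T n d (fun p => lsum (fun B => ind_nbox d B p) L)).
    - rewrite lattice_sum_lsum. apply lsum_le. intros B HB'.
      unfold ind_nbox. rewrite (lattice_sum_prod T n d (fun i => ind1 (fst B i) (snd B i))).
      apply rprod_le. intros i Hi. split; [apply Rmax_l|].
      destruct (HB B HB' i Hi) as [H1 H2]. apply Rabs_le_between in H1, H2.
      apply grid_sum_ind1_ge; try lra. now apply HL.
    - eapply Rle_trans; [apply lattice_sum_le; [easy | apply H]|].
      rewrite lattice_sum_lsum. apply lsum_le. intros B HB'.
      unfold ind_nbox. rewrite (lattice_sum_prod T n d (fun i => ind1 (fst B i) (snd B i))).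
      apply rprod_le. intros i Hi. split.
      + apply Rmult_le_pos; [left; now apply mesh_pos|]. apply cond_pos_sum. intros k. unfold ind1.
        split_Rle; lra.
      + apply grid_sum_ind1_le; [easy|]. now apply HL'. }
  change (Rbar_le (lsum (vol d) L) (lsum (vol d) L')).
  eapply is_lim_seq_le; [exact K | |].
  - apply lsum_lim. intros B HB'. apply rprod_lim. intros i Hi.
    specialize (HL B HB' i Hi).
    apply is_lim_seq_le_le with (u := fun n => snd B i - fst B i - mesh T n)
      (w := fun n => snd B i - fst B i + mesh T n).
    + intros n. pose proof (mesh_pos T n HT). unfold Rmax. destruct Rle_dec; lra.
    + replace (Finite (snd B i - fst B i)) with (Finite (snd B i - fst B i - 0)) by (f_equal; ring).
      apply is_lim_seq_minus'; [apply is_lim_seq_const | apply mesh_lim].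
    + replace (Finite (snd B i - fst B i)) with (Finite (snd B i - fst B i + 0)) by (f_equal; ring).
      apply is_lim_seq_plus'; [apply is_lim_seq_const | apply mesh_lim].
  - apply lsum_lim. intros B HB'. apply rprod_lim. intros i Hi.
    replace (Finite (snd B i - fst B i)) with (Finite (snd B i - fst B i + 0)) by (f_equal; ring).
    apply is_lim_seq_plus'; [apply is_lim_seq_const | apply mesh_lim].
Qed.

Lemma vol_cover d Q (L : list nbox) :
  proper_nbox d Q -> (forall B, In B L -> proper_nbox d B) ->
  (forall p, in_nbox d Q p -> exists B, In B L /\ in_nbox d B p) ->
  vol d Q <= lsum (vol d) L.
Proof.
  intros HQ HL H. replace (vol d Q) with (lsum (vol d) (Q :: nil)) by (simpl; ring).
  apply vol_le_of_ind_le; [intros B [<-|[]]; easy | easy |]. intros p. simpl.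
  assert (Hpos : forall B, 0 <= ind_nbox d B p).
  { intros B. destruct (classic (in_nbox d B p)) as [h|h].
    - rewrite ind_nbox_in by easy; lra.
    - rewrite ind_nbox_notin by easy; lra. }
  destruct (classic (in_nbox d Q p)) as [Hp|Hp].
  - rewrite ind_nbox_in by easy. destruct (H p Hp) as [B [HB Hin]].
    apply in_split in HB. destruct HB as [l1 [l2 ->]].
    rewrite lsum_app. simpl. rewrite (ind_nbox_in d B) by easy.
    pose proof (lsum_nonneg (fun B => ind_nbox d B p) l1 (fun a _ => Hpos a)).
    pose proof (lsum_nonneg (fun B => ind_nbox d B p) l2 (fun a _ => Hpos a)). lra.
  - rewrite ind_nbox_notin by easy. rewrite Rplus_0_l. apply lsum_nonneg. auto.
Qed.

Lemma vol_packing d Q (L : list nbox) :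
  proper_nbox d Q -> (forall B, In B L -> proper_nbox d B) ->
  (forall B p, In B L -> in_nbox d B p -> in_nbox d Q p) ->
  ForallOrdPairs (fun B B' => forall p, in_nbox d B p -> ~ in_nbox d B' p) L ->
  lsum (vol d) L <= vol d Q.
Proof.
  intros HQ HL Hin Hd. replace (vol d Q) with (lsum (vol d) (Q :: nil)) by (simpl; ring).
  apply vol_le_of_ind_le; [easy | intros B [<-|[]]; easy |]. intros p. simpl. rewrite Rplus_0_r.
  clear HL. induction Hd as [|B L HB Hd IH].
  - simpl. destruct (classic (in_nbox d Q p)) as [h|h];
      [rewrite ind_nbox_in by easy; lra | rewrite ind_nbox_notin by easy; lra].
  - simpl. destruct (classic (in_nbox d B p)) as [h|h].
    + rewrite (ind_nbox_in d B) by easy. rewrite (ind_nbox_in d Q) by (eapply Hin; [now left|easy]).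
      replace (lsum (fun B => ind_nbox d B p) L) with 0; [lra|].
      rewrite Forall_forall in HB. clear - HB h.
      induction L as [|B' L IH]; simpl; [easy|].
      rewrite <- IH by (intros; apply HB; [now right|easy]).
      rewrite ind_nbox_notin; [ring|]. apply HB; [now left | easy].
    + rewrite (ind_nbox_notin d B) by easy. rewrite Rplus_0_l. apply IH.
      intros B' p' HB'. apply Hin. now right.
Qed.

(** * Norms and compactness on R^d *)

Definition pt {d} (p : nat -> R) : Rd d := fun i => p (proj1_sig (Fin.to_nat i)).

Lemma coord_pt d p i : (i < d)%nat -> coord (pt p : Rd d) i = p i.
Proof.
  intros H. unfold coord, pt. destruct Compare_dec.lt_dec; [|easy].
  now rewrite Fin.to_nat_of_nat.
Qed.

Lemma coord_to_nat d (x : Rd d) i : coord x (proj1_sig (Fin.to_nat i)) = x i.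
Proof.
  unfold coord. destruct (Fin.to_nat i) as [n h] eqn:E. simpl.
  destruct Compare_dec.lt_dec as [h'|]; [|easy]. f_equal.
  rewrite (Fin.of_nat_ext h' h). pose proof (Fin.of_nat_to_nat_inv i) as Hi.
  now rewrite E in Hi.
Qed.

Lemma coord_bound_iff d (x : Rd d) (P : nat -> R -> Prop) :
  (forall k, (k < d)%nat -> P k (coord x k)) <->
  (forall i, P (proj1_sig (Fin.to_nat i)) (x i)).
Proof.
  split; intros H.
  - intros i. rewrite <- coord_to_nat. apply H. now destruct (Fin.to_nat i).
  - intros k h. unfold coord. destruct Compare_dec.lt_dec as [h'|]; [|easy].
    specialize (H (Fin.of_nat_lt h')). now rewrite Fin.to_nat_of_nat in H.
Qed.

Lemma box_vol_vol d (a b : Rd d) : box_vol a b = vol d (coord a, coord b).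
Proof.
  unfold box_vol, vol. simpl. generalize (fun i => coord b i - coord a i) as f. intros f.
  rewrite <- (Rmult_1_r (rprod d f)). generalize 1 as c. clear a b.
  induction d as [|d IH]; intros c; [simpl; ring|].
  rewrite seq_S, map_app, fold_right_app. simpl. rewrite IH. ring.
Qed.

(** Passage to and from the tuples [Tn d R], over which [compactness_list] is stated. *)
Fixpoint to_tn (d : nat) (p : nat -> R) : Tn d R :=
  match d with O => tt | S d' => (p O, to_tn d' (fun i => p (S i))) end.

Fixpoint of_tn (d : nat) : Tn d R -> nat -> R :=
  match d with
  | O => fun _ _ => 0
  | S d' => fun t i => match i with O => fst t | S i' => of_tn d' (snd t) i' end
  end.

Lemma bounded_to_tn d a b t :
  bounded_n d (to_tn d a) (to_tn d b) t <->
  forall i, (i < d)%nat -> a i <= of_tn d t i <= b i.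
Proof.
  revert a b t. induction d as [|d IH]; intros a b t.
  - split; [intros; lia | easy].
  - destruct t as [u t]. simpl. rewrite IH. split.
    + intros [H1 H2] [|i] Hi; [easy|]. apply (H2 i). lia.
    + intros H. split; [apply (H O); lia|]. intros i Hi. apply (H (S i)). lia.
Qed.

Lemma of_to_tn d p i : (i < d)%nat -> of_tn d (to_tn d p) i = p i.
Proof.
  revert p i. induction d as [|d IH]; intros p i H; [lia|].
  destruct i as [|i]; simpl; [easy|]. apply (IH (fun i => p (S i))). lia.
Qed.

Lemma close_of_tn d e s t :
  close_n d e s t -> forall i, (i < d)%nat -> Rabs (of_tn d s i - of_tn d t i) < e.
Proof.
  revert s t. induction d as [|d IH]; intros s t H i Hi; [lia|].
  destruct s as [u s], t as [v t]. simpl in H. destruct i as [|i]; simpl; [easy|].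
  apply IH; [easy | lia].
Qed.

Lemma box_compact d (a b : Rd d) (delta : Rd d -> R) :
  (forall y, (forall i, a i <= y i <= b i) -> 0 < delta y) ->
  exists l : list (Rd d), forall y, (forall i, a i <= y i <= b i) ->
    exists z, In z l /\ (forall i, a i <= z i <= b i) /\ forall i, Rabs (y i - z i) < delta z.
Proof.
  intros Hd.
  (* The gauge must be positive everywhere; the default 1 is used only where [delta] is not
     positive, hence never in the box. The conclusion of [compactness_list] is doubly negated,
     whence [NNPP]. *)
  set (del := fun t : Tn d R => match Rlt_dec 0 (delta (pt (of_tn d t))) with
     | left h => mkposreal _ h | right _ => mkposreal 1 Rlt_0_1 end).
  destruct (NNPP _ (compactness_list d (to_tn d (coord a)) (to_tn d (coord b)) del)) as [l Hl].
  exists (map (fun t => pt (of_tn d t)) l). intros y Hy.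
  assert (Hb : bounded_n d (to_tn d (coord a)) (to_tn d (coord b)) (to_tn d (coord y))).
  { apply bounded_to_tn. intros k Hk. rewrite of_to_tn by easy.
    apply (coord_bound_iff d y (fun k u => coord a k <= u <= coord b k)); [|easy].
    intros i. rewrite !coord_to_nat. apply Hy. }
  destruct (Hl _ Hb) as [t [Ht [Hbt Hct]]].
  rewrite bounded_to_tn in Hbt.
  assert (Hin : forall i, a i <= pt (of_tn d t) i <= b i).
  { intros i. unfold pt. rewrite <- (coord_to_nat d a), <- (coord_to_nat d b).
    apply Hbt. now destruct (Fin.to_nat i). }
  exists (pt (of_tn d t)). split; [|split; [easy|]].
  - now apply in_map with (f := fun t => pt (of_tn d t)).
  - intros i. assert (Hi : (proj1_sig (Fin.to_nat i) < d)%nat) by now destruct (Fin.to_nat i).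
    pose proof (close_of_tn _ _ _ _ Hct _ Hi) as H.
    rewrite of_to_tn, coord_to_nat in H by easy.
    unfold del in H. destruct Rlt_dec as [h|h]; [easy|].
    exfalso. apply h. now apply Hd.
Qed.

Lemma vsub_0_r d (y : Rd d) : vsub y (fun _ => 0) = y.
Proof. apply functional_extensionality; intros i; unfold vsub; ring. Qed.

Lemma vsub_diag d (y : Rd d) : vsub y y = fun _ => 0.
Proof. apply functional_extensionality; intros i; unfold vsub; ring. Qed.

Lemma norm_at_0 d (N : Rd d -> R) : is_norm N -> N (fun _ => 0) = 0.
Proof.
  intros (_ & _ & Hs & _). specialize (Hs 0 (fun _ => 0)).
  rewrite Rabs_R0, Rmult_0_l in Hs. transitivity (N (vscal 0 (fun _ => 0))); [|exact Hs]. f_equal.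
  apply functional_extensionality; intros i; unfold vscal; ring.
Qed.

Lemma norm_sym d (N : Rd d -> R) : is_norm N -> forall y z, N (vsub y z) = N (vsub z y).
Proof.
  intros (_ & _ & Hs & _) y z. rewrite <- (Rmult_1_l (N (vsub z y))).
  replace 1 with (Rabs (-1)) by (rewrite Rabs_left; lra). rewrite <- Hs. f_equal.
  apply functional_extensionality; intros i; unfold vscal, vsub; ring.
Qed.

Lemma norm_tri d (N : Rd d -> R) : is_norm N ->
  forall y z w, N (vsub y w) <= N (vsub y z) + N (vsub z w).
Proof.
  intros (_ & _ & _ & Ht) y z w. replace (vsub y w) with (vadd (vsub y z) (vsub z w)); [apply Ht|].
  apply functional_extensionality; intros i; unfold vadd, vsub; ring.
Qed.

(** The coordinates are added one at a time by the triangle inequality. The constant is 1 plus the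
    norms of the unit vectors, the 1 making it positive. *)
Lemma norm_le_sup d (N : Rd d -> R) : is_norm N ->
  exists b, 0 < b /\ forall s y, 0 <= s -> (forall i, Rabs (y i) <= s) -> N y <= b * s.
Proof.
  intros HN. pose proof (norm_at_0 d N HN) as H0. destruct HN as (Hp & _ & Hs & Ht).
  set (trunc := fun k (y : Rd d) => (fun i => if proj1_sig (Fin.to_nat i) <? k then y i else 0) : Rd d).
  assert (H : forall k, (k <= d)%nat -> exists b, 0 < b /\ forall s y,
    (forall i, Rabs (y i) <= s) -> 0 <= s -> N (trunc k y) <= b * s).
  { induction k as [|k IH]; intros Hk.
    - exists 1. split; [lra|]. intros s y Hy Hs0. unfold trunc. simpl. rewrite H0. lra.
    - destruct IH as [b [Hb IH]]; [lia|].
      set (e := (fun i => if proj1_sig (Fin.to_nat i) =? k then 1 else 0) : Rd d).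
      exists (b + N e). specialize (Hp e) as He. split; [lra|]. intros s y Hy Hs0.
      replace (trunc (S k) y) with (vadd (trunc k y) (vscal (coord y k) e)).
      + eapply Rle_trans; [apply Ht|]. rewrite Hs, Rmult_plus_distr_r.
        apply Rplus_le_compat; [now apply IH|]. rewrite Rmult_comm.
        apply Rmult_le_compat_l; [easy|].
        apply (coord_bound_iff d y (fun _ u => Rabs u <= s)); [easy | lia].
      + apply functional_extensionality; intros i. unfold trunc, vadd, vscal, e.
        rewrite <- (coord_to_nat d y i). destruct (Fin.to_nat i) as [n hn]; simpl.
        destruct (Nat.ltb_spec n k), (Nat.ltb_spec n (S k)), (Nat.eqb_spec n k); try lia; subst; ring. }
  destruct (H d (le_n d)) as [b [Hb Hb']]. exists b. split; [easy|]. intros s y Hs0 Hy.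
  assert (E : trunc d y = y).
  { apply functional_extensionality; intros i. unfold trunc. destruct (Fin.to_nat i) as [n hn]; simpl.
    now rewrite (proj2 (Nat.ltb_lt n d)). }
  rewrite <- E. now apply Hb'.
Qed.

Lemma max_index (d : nat) (f : nat -> R) :
  (0 < d)%nat -> exists k, (k < d)%nat /\ forall i, (i < d)%nat -> f i <= f k.
Proof.
  induction d as [|d IH]; intros H; [lia|]. destruct (Nat.eq_dec d 0) as [->|Hd].
  - exists O. split; [lia|]. intros i Hi. replace i with O by lia. lra.
  - destruct IH as [k [Hk IH]]; [lia|]. destruct (Rle_dec (f k) (f d)).
    + exists d. split; [lia|]. intros i Hi. destruct (Nat.eq_dec i d) as [->|]; [lra|].
      eapply Rle_trans; [apply IH; lia | easy].
    + exists k. split; [lia|]. intros i Hi. destruct (Nat.eq_dec i d) as [->|]; [lra|]. apply IH; lia.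
Qed.

(** By compactness of [[-1, 1] ^ d]. Around [z] with [N z > 0], the norm stays above [N z / 2] on
    the cube of half-side [N z / (2 * b)]. Around the origin, half-side [1 / 2] excludes the vectors
    of sup norm 1. Hence [a] bounds the norm below on those vectors, and scaling does the rest. *)
Lemma sup_le_norm d (N : Rd d -> R) : is_norm N ->
  exists a, 0 < a /\ forall y i, a * Rabs (y i) <= N y.
Proof.
  intros HN. destruct (norm_le_sup d N HN) as [b [Hb Hbs]].
  pose proof HN as (Hp & Hdef & Hs & Ht).
  set (del := fun y : Rd d => if Rlt_dec 0 (N y) then N y / (2 * b) else 1 / 2).
  destruct (box_compact d (fun _ => -1) (fun _ => 1) del) as [l Hl].
  { intros y _. unfold del. destruct Rlt_dec; [apply Rdiv_lt_0_compat; lra | lra]. }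
  assert (Ha : exists a, 0 < a /\ forall z, In z l -> 0 < N z -> a <= N z / 2).
  { clear Hl. induction l as [|z l [a [Ha IH]]]; [exists 1; split; [lra | now intros]|].
    destruct (Rlt_dec 0 (N z)) as [h|h].
    - exists (Rmin a (N z / 2)). split; [apply Rmin_glb_lt; lra|]. intros z' [<-|Hz] Hz'.
      + apply Rmin_r.
      + eapply Rle_trans; [apply Rmin_l | now apply IH].
    - exists a. split; [easy|]. intros z' [<-|Hz] Hz'; [easy | now apply IH]. }
  destruct Ha as [a [Ha Hal]]. exists a. split; [easy|].
  assert (Hunit : forall y i, (forall j, Rabs (y j) <= 1) -> Rabs (y i) = 1 -> a <= N y).
  { intros y i Hy Hi. destruct (Hl y) as [z [Hz [_ Hc]]].
    { intros j. specialize (Hy j). now apply Rabs_le_between in Hy. }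
    unfold del in Hc. destruct Rlt_dec as [h|h].
    - specialize (Hal z Hz h). pose proof (norm_tri d N HN z y (fun _ => 0)) as T1.
      rewrite vsub_0_r in T1.
      rewrite vsub_0_r in T1.
      rewrite (norm_sym d N HN z y) in T1.
      assert (T2 : N (vsub y z) <= b * (N z / (2 * b))) by (apply Hbs; [left; apply Rdiv_lt_0_compat; lra | intros j; left; apply Hc]).
      replace (b * (N z / (2 * b))) with (N z / 2) in T2 by (field; lra). lra.
    - assert (E : N z = 0) by (specialize (Hp z); lra).
      specialize (Hc i). rewrite (Hdef z E i), Rminus_0_r in Hc. lra. }
  intros y i. destruct (Req_dec (y i) 0) as [E|E].
  { rewrite E, Rabs_R0, Rmult_0_r. apply Hp. }
  assert (Hd : (0 < d)%nat) by (destruct d; [inversion i | lia]).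
  destruct (max_index d (fun k => Rabs (coord y k)) Hd) as [k [Hk Hmax]].
  set (m := Rabs (coord y k)) in *.
  assert (Hall : forall j, Rabs (y j) <= m).
  { apply (coord_bound_iff d y (fun _ u => Rabs u <= m)). intros; now apply Hmax. }
  assert (Hm : 0 < m) by (eapply Rlt_le_trans; [now apply Rabs_pos_lt, E | apply Hall]).
  assert (H1 : a <= N (vscal (/ m) y)).
  { apply Hunit with (i := Fin.of_nat_lt Hk).
    - intros j. unfold vscal. rewrite Rabs_mult, Rabs_inv, (Rabs_right m) by lra.
      apply Rmult_le_reg_l with m; [easy|]. rewrite <- Rmult_assoc, Rinv_r by lra. specialize (Hall j). lra.
    - unfold vscal. rewrite Rabs_mult, Rabs_inv, (Rabs_right m) by lra.
      rewrite <- (coord_to_nat d y). rewrite Fin.to_nat_of_nat. fold m. simpl. fold m. field. lra. }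
  rewrite Hs, Rabs_inv, (Rabs_right m) in H1 by lra.
  apply Rmult_le_compat_l with (r := m) in H1; [|lra].
  rewrite <- Rmult_assoc, Rinv_r, Rmult_1_l in H1 by lra.
  eapply Rle_trans; [|exact H1]. rewrite Rmult_comm. apply Rmult_le_compat_r; [lra | apply Hall].
Qed.

(** * Extraction of separated balls *)

Definition cube_nbox {d} (y : Rd d) (s : R) : nbox :=
  (fun k => coord y k - s, fun k => coord y k + s).

Lemma vol_cube_nbox d (y : Rd d) s : vol d (cube_nbox y s) = (2 * s) ^ d.
Proof. unfold vol. rewrite <- rprod_const. apply rprod_ext. intros i Hi. simpl. ring. Qed.

Lemma proper_cube_nbox d (y : Rd d) s : 0 <= s -> proper_nbox d (cube_nbox y s).
Proof. intros H k Hk. simpl. lra. Qed.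

Lemma in_cube_nbox d (y : Rd d) s p :
  in_nbox d (cube_nbox y s) p <-> forall i, Rabs (pt p i - y i) <= s.
Proof.
  split; intros H.
  - intros i. unfold pt. rewrite <- (coord_to_nat d y).
    specialize (H (proj1_sig (Fin.to_nat i))). simpl in H.
    apply Rabs_le. destruct (Fin.to_nat i) as [k hk]; simpl in *. specialize (H hk). lra.
  - intros k Hk. simpl.
    pose proof (proj2 (coord_bound_iff d y (fun k u => Rabs (p k - u) <= s))) as H1.
    specialize (H1 H k Hk). cbv beta in H1. apply Rabs_le_between in H1. lra.
Qed.

Definition separated {d I} (N : Rd d -> R) (x : I -> Rd d) (r : I -> R) (J : list I) : Prop :=
  ForallOrdPairs (fun i j => r i + r j <= N (vsub (x i) (x j))) J.

Lemma ForallOrdPairs_map {A B} (h : A -> B) (P : A -> A -> Prop) (Q : B -> B -> Prop) l :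
  (forall i j, In i l -> In j l -> P i j -> Q (h i) (h j)) ->
  ForallOrdPairs P l -> ForallOrdPairs Q (map h l).
Proof.
  intros H Hl. induction Hl as [|i l Hi Hl IH]; simpl; constructor.
  - rewrite Forall_forall in *. intros b Hb. apply in_map_iff in Hb.
    destruct Hb as [j [<- Hj]]. apply H; [now left | now right | now apply Hi].
  - apply IH. intros; apply H; [now right | now right | easy].
Qed.

(** The cubes of half-side [r i / (2 * b)] about the centres are disjoint, since a common point
    would give [N (vsub (x i) (x j)) <= (r i + r j) / 2]. They all lie in the cube of half-side
    [D * (/ a + / (2 * b))] about [y], and [K] comes from comparing volumes. *)
Lemma separated_packing d (N : Rd d -> R) : is_norm N ->
  exists K, 0 < K /\ forall (I : Type) (x : I -> Rd d) (r : I -> R) J y D,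
    separated N x r J -> 0 < D ->
    (forall i, In i J -> 0 < r i <= D /\ N (vsub (x i) y) <= D) ->
    lsum (fun i => r i ^ d) J <= K * D ^ d.
Proof.
  intros HN. destruct (norm_le_sup d N HN) as [b [Hb Hbs]].
  destruct (sup_le_norm d N HN) as [a [Ha Has]].
  assert (Hab : 0 < / a /\ 0 < / b) by (split; now apply Rinv_0_lt_compat).
  exists ((b * (2 * (/ a + / (2 * b)))) ^ d). split.
  { apply pow_lt. repeat apply Rmult_lt_0_compat; try lra. rewrite Rinv_mult. lra. }
  intros I x r J y D Hsep HD HJ.
  set (h := fun i => cube_nbox (x i) (r i / (2 * b))).
  assert (Hhalf : forall i, In i J -> 0 < r i / (2 * b) <= D * / (2 * b)).
  { intros i Hi. destruct (HJ i Hi) as [[H1 H2] _]. split.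
    - apply Rdiv_lt_0_compat; lra.
    - apply Rmult_le_compat_r; [rewrite Rinv_mult; lra | easy]. }
  assert (H : lsum (vol d) (map h J) <= vol d (cube_nbox y (D * (/ a + / (2 * b))))).
  { apply vol_packing.
    - apply proper_cube_nbox. apply Rmult_le_pos; [lra|]. rewrite Rinv_mult. lra.
    - intros B HB. apply in_map_iff in HB. destruct HB as [i [<- Hi]].
      apply proper_cube_nbox. specialize (Hhalf i Hi). lra.
    - intros B p HB. apply in_map_iff in HB. destruct HB as [i [<- Hi]]. unfold h.
      rewrite !in_cube_nbox. intros Hp k. specialize (Hp k). specialize (Hhalf i Hi).
      destruct (HJ i Hi) as [_ H2]. specialize (Has (vsub (x i) y) k).
      assert (H3 : Rabs (x i k - y k) <= D * / a).
      { unfold vsub in Has at 1. apply Rmult_le_reg_l with a; [easy|].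
        replace (a * (D * / a)) with D by (field; lra). lra. }
      replace (pt p k - y k) with ((pt p k - x i k) + (x i k - y k)) by ring.
      eapply Rle_trans; [apply Rabs_triang|]. rewrite Rmult_plus_distr_l. lra.
    - eapply ForallOrdPairs_map; [|exact Hsep]. intros i j Hi Hj Hij p. unfold h.
      rewrite !in_cube_nbox. intros H1 H2.
      destruct (HJ i Hi) as [[Hri _] _]. destruct (HJ j Hj) as [[Hrj _] _].
      assert (H3 : N (vsub (x i) (x j)) <= b * ((r i + r j) / (2 * b))).
      { apply Hbs; [left; apply Rdiv_lt_0_compat; lra|]. intros k. unfold vsub.
        specialize (H1 k). specialize (H2 k). rewrite Rabs_minus_sym in H1.
        replace (x i k - x j k) with ((x i k - pt p k) + (pt p k - x j k)) by ring.
        eapply Rle_trans; [apply Rabs_triang|].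
        replace ((r i + r j) / (2 * b)) with (r i / (2 * b) + r j / (2 * b)) by (field; lra). lra. }
      replace (b * ((r i + r j) / (2 * b))) with ((r i + r j) / 2) in H3 by (field; lra). lra. }
  rewrite lsum_map, vol_cube_nbox in H.
  replace (lsum (fun i => r i ^ d) J) with (b ^ d * lsum (fun i => vol d (h i)) J).
  - rewrite Rpow_mult_distr, Rmult_assoc, <- Rpow_mult_distr.
    apply Rmult_le_compat_l; [apply pow_le; lra|].
    eapply Rle_trans; [exact H|]. right. f_equal. ring.
  - rewrite <- lsum_scal. f_equal. apply functional_extensionality. intros i. unfold h.
    rewrite vol_cube_nbox, <- Rpow_mult_distr. f_equal. field. lra.
Qed.

Lemma max_in_list {I} (r : I -> R) i0 (J : list I) :
  exists i, In i (i0 :: J) /\ forall j, In j (i0 :: J) -> r j <= r i.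
Proof.
  revert i0. induction J as [|k J IH]; intros i0.
  - exists i0. split; [now left|]. intros j [<-|[]]; lra.
  - destruct (IH k) as [i [Hi H]]. destruct (Rle_dec (r i) (r i0)).
    + exists i0. split; [now left|]. intros j [<-|Hj]; [lra|]. specialize (H j Hj). lra.
    + exists i. split; [now right|]. intros j [<-|Hj]; [lra|]. now apply H.
Qed.

(** Greedy choice: keep a ball [m] of largest radius, discard the balls not separated from it, and
    recurse on the others. A point of a discarded ball [j] is within [r j + (r m + r j) <= 3 * r m]
    of the centre of [m]. *)
Lemma vitali_finite d I (N : Rd d -> R) (x : I -> Rd d) (r : I -> R) : is_norm N ->
  (forall i, 0 < r i) ->
  forall J, exists J', incl J' J /\ separated N x r J' /\
    forall i, In i J -> exists j, In j J' /\
      forall y, N (vsub y (x i)) < r i -> N (vsub y (x j)) <= 3 * r j.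
Proof.
  intros HN Hr J. remember (length J) as n eqn:Hn. revert J Hn.
  induction n as [n IH] using lt_wf_ind. intros J Hn.
  destruct J as [|i0 J0]; [exists nil; repeat split; [easy | constructor | easy]|].
  destruct (max_in_list r i0 J0) as [m [Hm Hmax]].
  set (far := fun j => if Rle_dec (r m + r j) (N (vsub (x m) (x j))) then true else false).
  set (J := i0 :: J0) in *.
  assert (Hlen : (length (filter far J) < n)%nat).
  { rewrite Hn. apply in_split in Hm. destruct Hm as [l1 [l2 ->]].
    rewrite filter_app, !length_app. simpl.
    assert (E : far m = false).
    { unfold far. destruct Rle_dec as [h|h]; [|easy]. exfalso.
      rewrite vsub_diag in h.
      rewrite (norm_at_0 d N HN) in h. specialize (Hr m). lra. }
    rewrite E. pose proof (filter_length_le far l1). pose proof (filter_length_le far l2). lia. }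
  destruct (IH _ Hlen (filter far J) eq_refl) as [J' [Hincl [Hsep Hcov]]].
  exists (m :: J'). repeat split.
  - intros j [<-|Hj]; [easy|]. apply Hincl in Hj. now apply filter_In in Hj.
  - constructor; [|easy]. apply Forall_forall. intros j Hj. apply Hincl, filter_In in Hj.
    destruct Hj as [_ Hj]. unfold far in Hj. now destruct Rle_dec.
  - intros j Hj. destruct (far j) eqn:E.
    + destruct (Hcov j) as [k [Hk H]]; [now apply filter_In|]. exists k. split; [now right | easy].
    + exists m. split; [now left|]. intros y Hy. unfold far in E. destruct Rle_dec; [easy|].
      pose proof (norm_tri d N HN y (x j) (x m)) as T1. rewrite (norm_sym d N HN (x j)) in T1.
      specialize (Hmax j Hj). lra.
Qed.

(** Compactness needs a neighbourhood of every point of a closed box to be covered too; the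
    thickening provides it at an arbitrarily small cost in volume. *)
Lemma enlarge_nbox d (a b : nat -> R) e : 0 < e ->
  exists th, 0 < th /\
    vol d (fun k => a k - th, fun k => b k + th) <= vol d (a, b) + e.
Proof.
  intros He.
  assert (L : is_lim_seq (fun n => vol d (fun k => a k - mesh 1 n, fun k => b k + mesh 1 n))
                         (vol d (a, b))).
  { unfold vol. simpl. apply rprod_lim. intros i _.
    replace (Finite (b i - a i)) with (Finite ((b i + 0) - (a i - 0))) by (f_equal; ring).
    apply is_lim_seq_minus'; [apply is_lim_seq_plus' | apply is_lim_seq_minus'];
      auto using is_lim_seq_const, mesh_lim. }
  apply is_lim_seq_spec in L. destruct (L (mkposreal e He)) as [n Hn].
  exists (mesh 1 n). split; [apply mesh_pos; lra|].
  specialize (Hn n (le_n n)). apply Rabs_lt_between in Hn. simpl in Hn. lra.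
Qed.

Lemma sum_geom_le e M : 0 <= e -> sum_f_R0 (fun n => e * (1 / 2) ^ S n) M <= e.
Proof.
  intros He. cut (sum_f_R0 (fun n => e * (1 / 2) ^ S n) M = e - e * (1 / 2) ^ S M).
  - intros ->. assert (0 <= (1 / 2) ^ S M) by (apply pow_le; lra).
    pose proof (Rmult_le_pos _ _ He H). lra.
  - induction M as [|M IH]; [simpl; field|]. cbn [sum_f_R0]. rewrite IH. simpl. field.
Qed.

Lemma lsum_seq f M : lsum f (seq 0 (S M)) = sum_f_R0 f M.
Proof.
  induction M as [|M IH]; [simpl; ring|]. rewrite seq_S, lsum_app, IH. simpl. ring.
Qed.

(** If every ball containing [y] had radius above [eta], then all their centres would be bounded and
    their radii bounded below, leaving only finitely many of them. *)
Lemma small_radius_index d I (N : Rd d -> R) (x : I -> Rd d) (r : I -> R) y eta :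
  is_norm N -> approx_system N x r -> F_t N x r 1 y -> 0 < eta ->
  exists i, N (vsub y (x i)) < r i /\ r i <= eta.
Proof.
  intros HN (Hr & [M HM] & Hfin) HF Heta. apply NNPP. intros Hno. apply HF.
  destruct (INR_unbounded (N y + M + / eta)) as [m Hm].
  assert (HN0 : 0 <= N y) by apply HN.
  assert (HI : 0 < / eta) by now apply Rinv_0_lt_compat.
  destruct (Hfin m) as [l Hl]. exists l. intros i Hi. apply Hl.
  rewrite Rpower_1 in Hi by apply Hr.
  specialize (Hr i). specialize (HM i). split.
  - pose proof (norm_tri d N HN (x i) y (fun _ => 0)) as T1.
    rewrite vsub_0_r in T1.
    rewrite vsub_0_r in T1.
    rewrite (norm_sym d N HN (x i)) in T1. lra.
  - apply Rlt_le_trans with eta.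
    + unfold Rdiv. rewrite Rmult_1_l, <- (Rinv_inv eta). apply Rinv_lt_contravar; [|lra].
      apply Rmult_lt_0_compat; lra.
    + left. apply Rnot_le_lt. intros h. apply Hno. now exists i.
Qed.

(* Compactness reduces the cover of a cube by the null set and the small balls to a finite
   one, from which Vitali's argument extracts separated balls of comparable total volume. *)
Lemma ubiquitous_selection d I (N : Rd d -> R) (x : I -> Rd d) (r : I -> R) (U : Rd d -> Prop) :
  is_norm N -> homogeneous_ubiquitous N x r U ->
  exists kappa, 0 < kappa /\ forall c rho eta, 0 < rho -> 0 < eta ->
    (forall y, N (vsub y c) <= rho -> U y) ->
    exists J, separated N x r J /\
      (forall i, In i J -> r i <= eta /\ N (vsub (x i) c) + r i <= rho) /\
      kappa * rho ^ d <= lsum (fun i => r i ^ d) J.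
Proof.
  intros HN (Hsys & _ & _ & Hnull).
  destruct (norm_le_sup d N HN) as [b [Hb Hbs]].
  destruct (sup_le_norm d N HN) as [a [Ha Has]].
  (* The cube of half-side [rho / (2 * b)] has volume [V = (rho / b) ^ d]. The boxes covering the
     null set take at most [V / 2], and a ball tripled by Vitali's argument lies in a cube of volume
     [(6 * r i / a) ^ d]. *)
  exists ((a / (6 * b)) ^ d / 2). split.
  { apply Rdiv_lt_0_compat; [apply pow_lt, Rdiv_lt_0_compat |]; lra. }
  intros c rho eta0 Hrho Heta0 HU.
  (* Points of the cube are within [rho / 2] of [c], so a ball of radius at most [rho / 4]
     containing one of them lies in the ball of radius [rho]. *)
  set (eta := Rmin eta0 (rho / 4)).
  assert (Heta : 0 < eta) by (apply Rmin_glb_lt; lra).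
  assert (Heta1 : eta <= eta0) by apply Rmin_l.
  assert (Heta2 : eta <= rho / 4) by apply Rmin_r.
  set (ell := rho / (2 * b)).
  assert (Hell : 0 < ell) by (apply Rdiv_lt_0_compat; lra).
  assert (Hbell : b * ell = rho / 2) by (unfold ell; field; lra).
  set (V := (2 * ell) ^ d).
  assert (HV : 0 < V) by (apply pow_lt; lra).
  destruct (Hnull (V / 4)) as [al [be [Hab [Hcov Hsum]]]]; [lra|].
  assert (Hth : forall n, exists th, 0 < th /\
     vol d (fun k => coord (al n) k - th, fun k => coord (be n) k + th)
     <= box_vol (al n) (be n) + V / 4 * (1 / 2) ^ S n).
  { intros n. rewrite box_vol_vol. apply enlarge_nbox.
    apply Rmult_lt_0_compat; [lra | apply pow_lt; lra]. }
  set (th := fun n => proj1_sig (constructive_indefinite_description _ (Hth n))).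
  assert (Hth1 : forall n, 0 < th n) by
    (intros n; exact (proj1 (proj2_sig (constructive_indefinite_description _ (Hth n))))).
  assert (Hth2 : forall n, _) by
    (intros n; exact (proj2 (proj2_sig (constructive_indefinite_description _ (Hth n))))).
  fold (th 0%nat) in Hth2.
  set (box := fun n => (fun k => coord (al n) k - th n, fun k => coord (be n) k + th n) : nbox).
  assert (Hbox : forall n, vol d (box n) <= box_vol (al n) (be n) + V / 4 * (1 / 2) ^ S n) by exact Hth2.
  clear Hth2. clearbody th. clear Hth.
  set (good := fun i => r i <= eta /\ N (vsub (x i) c) + r i <= rho).
  set (inQ := fun y : Rd d => forall i, c i - ell <= y i <= c i + ell).
  (* [w] packs the size of a neighbourhood of [y] with a label of what covers it: a thickened box of
     the null cover, or a ball of the system. *)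
  set (P := fun (y : Rd d) (w : R * (nat + I)) => 0 < fst w /\
     match snd w with
     | inl n => forall z, (forall i, Rabs (z i - y i) < fst w) ->
                  forall i, al n i - th n <= z i <= be n i + th n
     | inr i => good i /\ forall z, (forall k, Rabs (z k - y k) < fst w) -> N (vsub z (x i)) < r i
     end).
  assert (Hloc : forall y, exists w, inQ y -> P y w).
  { intros y. destruct (classic (inQ y)) as [HQ|HQ]; [|exists (1, inl O); easy].
    assert (Hyc : N (vsub y c) <= rho / 2).
    { rewrite <- Hbell. apply Hbs; [lra|]. intros i. specialize (HQ i). apply Rabs_le. unfold vsub. lra. }
    destruct (classic (F_t N x r 1 y)) as [HF|HF].
    - destruct (small_radius_index d I N x r y eta HN Hsys HF Heta) as [i [Hi1 Hi2]].
      exists ((r i - N (vsub y (x i))) / (2 * b), inr i). intros _.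
      assert (Hw : 0 < (r i - N (vsub y (x i))) / (2 * b)) by (apply Rdiv_lt_0_compat; lra).
      split; [easy|]. simpl. split; [split; [easy|]|].
      + pose proof (norm_tri d N HN (x i) y c) as T1. rewrite (norm_sym d N HN (x i) y) in T1. lra.
      + intros z Hz. pose proof (norm_tri d N HN z y (x i)) as T1.
        assert (T2 : N (vsub z y) <= b * ((r i - N (vsub y (x i))) / (2 * b)))
          by (apply Hbs; [lra | intros k; left; apply Hz]).
        replace (b * ((r i - N (vsub y (x i))) / (2 * b))) with ((r i - N (vsub y (x i))) / 2) in T2
          by (field; lra). lra.
    - destruct (Hcov y) as [n Hn]; [split; [apply HU; lra | easy]|].
      exists (th n, inl n). intros _. split; [apply Hth1|]. simpl. intros z Hz i.
      specialize (Hz i). specialize (Hn i). apply Rabs_lt_between in Hz. lra. }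
  set (w := fun y => proj1_sig (constructive_indefinite_description _ (Hloc y))).
  assert (Hw : forall y, inQ y -> P y (w y)) by
    (intros y; exact (proj2_sig (constructive_indefinite_description _ (Hloc y)))).
  clearbody w. clear Hloc.
  destruct (box_compact d (fun i => c i - ell) (fun i => c i + ell) (fun y => fst (w y))) as [l Hl].
  { intros y Hy. now apply Hw. }
  assert (Hfin : exists J0 M, (forall i, In i J0 -> good i) /\ forall z, In z l -> inQ z ->
     match snd (w z) with inl n => (n <= M)%nat | inr i => In i J0 end).
  { clear Hl. induction l as [|z l (J0 & M & H1 & H2)]; [exists nil, O; easy|].
    destruct (classic (inQ z)) as [HQ|HQ].
    - destruct (Hw z HQ) as [_ HP]. destruct (snd (w z)) as [n|i] eqn:E.
      + exists J0, (Nat.max n M). split; [easy|]. intros z' [<-|Hz'] HQ'.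
        * rewrite E. lia.
        * specialize (H2 z' Hz' HQ'). destruct (snd (w z')); [lia | easy].
      + exists (i :: J0), M. split; [intros j [<-|Hj]; [apply HP | now apply H1]|].
        intros z' [<-|Hz'] HQ'.
        * rewrite E. now left.
        * specialize (H2 z' Hz' HQ'). destruct (snd (w z')); [easy | now right].
    - exists J0, M. split; [easy|]. intros z' [<-|Hz'] HQ'; [easy | now apply H2]. }
  destruct Hfin as (J0 & M & Hgood & Hidx).
  destruct (vitali_finite d I N x r HN (proj1 Hsys) J0) as [J [Hincl [Hsep Hvit]]].
  exists J. split; [easy|]. split.
  { intros i Hi. destruct (Hgood i (Hincl i Hi)). split; lra. }
  pose proof (proj1 Hsys) as Hr.
  set (L := map box (seq 0 (S M)) ++ map (fun j => cube_nbox (x j) (3 * r j / a)) J).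
  assert (HL : vol d (cube_nbox c ell) <= lsum (vol d) L).
  { apply vol_cover.
    - apply proper_cube_nbox; lra.
    - intros B HB. apply in_app_or in HB. destruct HB as [HB|HB]; apply in_map_iff in HB;
        destruct HB as [n [<- _]].
      + intros k Hk. simpl.
        pose proof (proj2 (coord_bound_iff d (be n) (fun k u => coord (al n) k <= u))) as H1.
        assert (H2 : coord (al n) k <= coord (be n) k).
        { apply H1; [|easy]. intros i. rewrite coord_to_nat. apply Hab. }
        specialize (Hth1 n). lra.
      + apply proper_cube_nbox. specialize (Hr n). left. apply Rdiv_lt_0_compat; lra.
    - intros p Hp. rewrite in_cube_nbox in Hp.
      destruct (Hl (pt p)) as [z [Hz [HQz Hclose]]].
      { intros i. specialize (Hp i). apply Rabs_le_between in Hp. lra. }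
      destruct (Hw z HQz) as [_ HPz]. specialize (Hidx z Hz HQz).
      destruct (snd (w z)) as [n|i].
      + exists (box n). split.
        * apply in_or_app. left. apply in_map, in_seq. lia.
        * intros k Hk. simpl. specialize (HPz (pt p) Hclose).
          rewrite <- (coord_pt d p k Hk).
          apply (coord_bound_iff d (pt p) (fun k u => coord (al n) k - th n <= u <= coord (be n) k + th n)); [|easy].
          intros i. rewrite !coord_to_nat. apply HPz.
      + destruct HPz as [_ HPz]. specialize (HPz (pt p) Hclose).
        destruct (Hvit i Hidx) as [j [Hj H3]]. specialize (H3 _ HPz).
        exists (cube_nbox (x j) (3 * r j / a)). split.
        * apply in_or_app. right. now apply (in_map (fun j => cube_nbox (x j) (3 * r j / a))).
        * apply in_cube_nbox. intros k. specialize (Has (vsub (pt p) (x j)) k).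
          unfold vsub in Has at 1. apply Rmult_le_reg_l with a; [easy|].
          replace (a * (3 * r j / a)) with (3 * r j) by (field; lra). lra. }
  unfold L in HL. rewrite vol_cube_nbox, lsum_app, !lsum_map, lsum_seq in HL. fold V in HL.
  assert (H1 : sum_f_R0 (fun n => vol d (box n)) M <= V / 4 + V / 4).
  { eapply Rle_trans; [apply sum_Rle; intros n _; apply Hbox|]. rewrite sum_plus.
    apply Rplus_le_compat; [apply Hsum | apply sum_geom_le; lra]. }
  assert (H2 : lsum (fun j => vol d (cube_nbox (x j) (3 * r j / a))) J
               = (6 / a) ^ d * lsum (fun i => r i ^ d) J).
  { rewrite <- lsum_scal. f_equal. apply functional_extensionality. intros j.
    rewrite vol_cube_nbox, <- Rpow_mult_distr. f_equal. field. lra. }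
  rewrite H2 in HL.
  assert (H3 : 0 < (a / 6) ^ d) by (apply pow_lt; lra).
  assert (H4 : V / 2 <= (6 / a) ^ d * lsum (fun i => r i ^ d) J) by lra.
  apply Rmult_le_compat_l with (r := (a / 6) ^ d) in H4; [|lra].
  rewrite <- Rmult_assoc, <- Rpow_mult_distr in H4.
  replace (a / 6 * (6 / a)) with 1 in H4 by (field; lra). rewrite pow1, Rmult_1_l in H4.
  eapply Rle_trans; [|exact H4]. right. unfold V, Rdiv.
  rewrite <- (Rmult_assoc ((a * / 6) ^ d)), <- Rpow_mult_distr.
  rewrite (Rmult_comm ((a * / (6 * b)) ^ d)), Rmult_assoc, <- Rpow_mult_distr, Rmult_comm.
  f_equal. f_equal. unfold ell. field. lra.
Qed.

(** * The gauge functions *)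

(** All estimates on the gauge are made in the variable [u = - ln r], which removes the absolute
    value. *)
Lemma gauge_log_exp d t u : 0 < u ->
  gauge_log d t (exp (- u)) = exp (- (INR d / t * u)) * u.
Proof.
  intros Hu. unfold gauge_log. pose proof (exp_pos (- u)). destruct Rle_dec; [lra|].
  unfold Rpower. rewrite ln_exp, Rabs_Ropp, Rabs_right by lra. do 2 f_equal. ring.
Qed.

Lemma exp_neg_ln r : 0 < r < 1 -> exists u, 0 < u /\ r = exp (- u).
Proof.
  intros Hr. exists (- ln r). split.
  - pose proof (ln_increasing r 1). rewrite ln_1 in H. lra.
  - rewrite Ropp_involutive, exp_ln; lra.
Qed.

Lemma exp_neg_le u v : exp (- u) <= exp (- v) -> v <= u.
Proof.
  intros H. destruct (Rle_dec v u) as [|h]; [easy|]. exfalso.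
  pose proof (exp_increasing (- v) (- u)). lra.
Qed.

Lemma gauge_log_pos d t r : 0 < r < 1 -> 0 < gauge_log d t r.
Proof.
  intros Hr. destruct (exp_neg_ln r Hr) as [u [Hu ->]]. rewrite gauge_log_exp by easy.
  apply Rmult_lt_0_compat; [apply exp_pos | easy].
Qed.

Lemma gauge_log_nonneg d t r : 0 <= gauge_log d t r.
Proof.
  unfold gauge_log. destruct Rle_dec; [lra|].
  apply Rmult_le_pos; [left; apply exp_pos | apply Rabs_pos].
Qed.

(* With [a = d / t] and [r = exp (- u)], the gauge is [u * exp (- a u)], decreasing in [u] once
   [a u >= 1], since [v / u = 1 + (v - u) / u <= 1 + a (v - u) <= exp (a (v - u))]. *)
Lemma gauge_log_mono d t x y : (1 <= d)%nat -> 1 < t ->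
  0 < x <= y -> y <= exp (- (t / INR d)) -> gauge_log d t x <= gauge_log d t y.
Proof.
  intros Hd Ht Hxy Hy. assert (HD : 0 < INR d) by (apply lt_0_INR; lia).
  assert (Htd : 0 < t / INR d) by (apply Rdiv_lt_0_compat; lra).
  assert (exp (- (t / INR d)) < 1) by (rewrite <- exp_0; apply exp_increasing; lra).
  destruct (exp_neg_ln x) as [v [Hv ->]]; [lra|].
  destruct (exp_neg_ln y) as [u [Hu ->]]; [lra|].
  assert (Huv : u <= v) by (apply exp_neg_le; lra).
  apply exp_neg_le in Hy.
  rewrite !gauge_log_exp by easy. set (a := INR d / t).
  assert (Ha : 0 < a) by (apply Rdiv_lt_0_compat; lra).
  assert (Hau : 1 <= a * u).
  { replace 1 with (a * (t / INR d)) by (unfold a; field; lra). apply Rmult_le_compat_l; lra. }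
  replace (- (a * u)) with (- (a * v) + a * (v - u)) by ring.
  rewrite exp_plus, Rmult_assoc. apply Rmult_le_compat_l; [left; apply exp_pos|].
  pose proof (exp_ineq1_le (a * (v - u))) as H1.
  apply Rle_trans with ((1 + a * (v - u)) * u); [nra | apply Rmult_le_compat_r; lra].
Qed.

(** In the variable [u], the ratio of the gauge to [r ^ d] is [u * exp ((d - d / t) * u)], which
    increases with [u] because [t > 1]. *)
Lemma gauge_log_ratio d t x y : (1 <= d)%nat -> 1 < t ->
  0 < x <= y -> y < 1 -> gauge_log d t y * x ^ d <= gauge_log d t x * y ^ d.
Proof.
  intros Hd Ht Hxy Hy. assert (HD : 0 < INR d) by (apply lt_0_INR; lia).
  destruct (exp_neg_ln x) as [v [Hv ->]]; [lra|].
  destruct (exp_neg_ln y) as [u [Hu ->]]; [lra|].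
  assert (Huv : u <= v) by (apply exp_neg_le; lra).
  rewrite !gauge_log_exp by easy. set (a := INR d / t).
  assert (Ha : a < INR d).
  { apply Rmult_lt_reg_r with t; [lra|]. unfold a. field_simplify; [nra | lra]. }
  rewrite <- !Rpower_pow by apply exp_pos. unfold Rpower. rewrite !ln_exp.
  set (A := exp (- (a * u))) in *.
  replace (A * u * exp (INR d * - v)) with ((A * exp (INR d * - v)) * u) by ring.
  replace (exp (- (a * v)) * v * exp (INR d * - u)) with ((exp (- (a * v)) * exp (INR d * - u)) * v) by ring.
  unfold A. rewrite <- !exp_plus.
  apply Rmult_le_compat; [left; apply exp_pos | lra | | lra].
  destruct (Req_dec u v) as [->|]; [right; f_equal; ring|].
  left. apply exp_increasing. nra.
Qed.

Lemma sq_le_exp u : 0 <= u -> u * u <= 4 * exp u.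
Proof.
  intros Hu. replace u with (u / 2 + u / 2) at 3 by field. rewrite exp_plus.
  pose proof (exp_ineq1_le (u / 2)). nra.
Qed.

Lemma gauge_log_small d t e rho : (1 <= d)%nat -> 1 < t -> 0 < e -> 0 < rho ->
  exists D, 0 < D <= rho /\ gauge_log d t D <= e.
Proof.
  intros Hd Ht He Hrho. assert (HD : 0 < INR d) by (apply lt_0_INR; lia).
  set (a := INR d / t).
  assert (Ha : 0 < a) by (apply Rdiv_lt_0_compat; lra).
  (* From [(a * u) ^ 2 <= 4 * exp (a * u)], the inequality [u * exp (- (a * u)) <= e] holds as soon
     as [u >= 4 / (a * a * e)]. *)
  set (u := Rmax (Rmax 1 (- ln rho)) (4 / (a * a * e))).
  assert (Hu1 : 1 <= u) by (eapply Rle_trans; [|apply Rmax_l]; apply Rmax_l).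
  assert (Hu2 : - ln rho <= u) by (eapply Rle_trans; [|apply Rmax_l]; apply Rmax_r).
  assert (Hu3 : 4 / (a * a * e) <= u) by apply Rmax_r.
  exists (exp (- u)). split.
  - split; [apply exp_pos|]. rewrite <- (exp_ln rho) by easy.
    destruct (Req_dec (- u) (ln rho)) as [->|]; [lra|]. left. apply exp_increasing. lra.
  - rewrite gauge_log_exp by lra. fold a.
    assert (Hae : 0 < a * a * e) by (apply Rmult_lt_0_compat; [now apply Rmult_lt_0_compat | easy]).
    apply Rmult_le_compat_r with (r := a * a * e) in Hu3; [|lra].
    replace (4 / (a * a * e) * (a * a * e)) with 4 in Hu3 by (field; lra).
    pose proof (sq_le_exp (a * u)) as H. specialize (H ltac:(nra)).
    pose proof (exp_pos (a * u)). rewrite exp_Ropp.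
    apply Rmult_le_reg_l with (exp (a * u)); [easy|].
    rewrite <- Rmult_assoc, Rinv_r, Rmult_1_l by lra.
    assert (4 * u <= 4 * (exp (a * u) * e)); [|lra].
    apply Rle_trans with (u * (a * a * e) * u); [nra|].
    replace (u * (a * a * e) * u) with (e * (a * u * (a * u))) by ring. nra.
Qed.

(** The claim is [u <= exp (c * u)] with [c = d / t - s], true for [u >= 4 / (c * c)] by the
    quadratic bound on [exp]. It carries positivity over to every exponent below [d / t], which is
    the dimension bound. *)
Lemma gauge_log_le_pow d t s : 0 < s < INR d / t ->
  exists rho, 0 < rho /\ forall r, r <= rho -> gauge_log d t r <= gauge_pow s r.
Proof.
  intros Hs. set (c := INR d / t - s). assert (Hc : 0 < c) by (unfold c; lra).
  assert (Hcc : 0 < c * c) by (apply Rmult_lt_0_compat; easy).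
  assert (Hq : 0 < 4 / (c * c)) by (apply Rdiv_lt_0_compat; lra).
  exists (exp (- (4 / (c * c)))). split; [apply exp_pos|]. intros r Hr.
  destruct (Rle_dec r 0) as [h|h].
  { unfold gauge_log, gauge_pow. destruct Rle_dec; lra. }
  assert (exp (- (4 / (c * c))) < 1) by (rewrite <- exp_0; apply exp_increasing; lra).
  destruct (exp_neg_ln r) as [u [Hu ->]]; [lra|].
  rewrite gauge_log_exp by easy. unfold gauge_pow. destruct Rle_dec; [easy|].
  unfold Rpower. rewrite ln_exp. apply exp_neg_le in Hr.
  replace (s * - u) with (- (INR d / t * u) + c * u) by (unfold c; ring).
  rewrite exp_plus. apply Rmult_le_compat_l; [left; apply exp_pos|].
  pose proof (sq_le_exp (c * u)) as H1. specialize (H1 ltac:(nra)).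
  apply Rmult_le_compat_r with (r := c * c) in Hr; [|lra].
  replace (4 / (c * c) * (c * c)) with 4 in Hr by (field; lra). nra.
Qed.

(** * Subdivision of mass *)

Lemma term_le_Series u n : (forall k, 0 <= u k) -> ex_series u -> u n <= Series u.
Proof.
  intros Hu Hex. pose proof (Series_correct u Hex) as H.
  apply Rle_trans with (sum_n u n).
  - destruct n as [|n]; [rewrite sum_O; lra|]. rewrite sum_Sn. unfold plus; simpl.
    assert (0 <= sum_n u n); [|lra]. rewrite sum_n_Reals. now apply cond_pos_sum.
  - apply is_lim_seq_incr_compare; [exact H|]. intros k. rewrite sum_Sn. unfold plus; simpl.
    specialize (Hu (S k)). lra.
Qed.

Lemma ex_series_bounded u B : (forall n, 0 <= u n) -> (forall M, sum_f_R0 u M <= B) ->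
  ex_series u /\ Series u <= B.
Proof.
  intros Hu HB.
  assert (Hex : ex_series u).
  { destruct (ex_finite_lim_seq_incr (sum_n u) B) as [l Hl].
    - intros n. rewrite sum_Sn. unfold plus; simpl. specialize (Hu (S n)). lra.
    - intros n. rewrite sum_n_Reals. apply HB.
    - exists l. exact Hl. }
  split; [easy|]. pose proof (Series_correct u Hex) as H.
  change (Rbar_le (Series u) B).
  eapply is_lim_seq_le; [|exact H | apply is_lim_seq_const].
  intros n. rewrite sum_n_Reals. apply HB.
Qed.

Lemma ex_series_dominated (u v : nat -> R) :
  (forall n, 0 <= u n <= v n) -> ex_series v -> ex_series u.
Proof.
  intros H. apply (ex_series_le u v). intros n. specialize (H n).
  unfold norm; simpl. unfold abs; simpl. rewrite Rabs_right; lra.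
Qed.

Lemma Series_lsum {I} (u : I -> nat -> R) J : (forall i, In i J -> ex_series (u i)) ->
  ex_series (fun n => lsum (fun i => u i n) J) /\
  Series (fun n => lsum (fun i => u i n) J) = lsum (fun i => Series (u i)) J.
Proof.
  induction J as [|i J IH]; simpl; intros H.
  - destruct (ex_series_bounded (fun _ => 0) 0) as [H1 H2].
    + intros; lra.
    + intros M. induction M; simpl; lra.
    + split; [easy|]. apply Rle_antisym; [easy|].
      apply (term_le_Series (fun _ => 0) O); [intros; lra | easy].
  - destruct IH as [H1 H2]; [intros; apply H; now right|].
    assert (H3 : ex_series (u i)) by (apply H; now left). split.
    + apply (ex_series_plus (u i) _ H3 H1).
    + rewrite Series_plus by easy. now rewrite H2.
Qed.

Lemma lsum_ge_term {I} (f : I -> R) J i : (forall j, In j J -> 0 <= f j) -> In i J -> f i <= lsum f J.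
Proof.
  intros Hf Hi. apply in_split in Hi. destruct Hi as [l1 [l2 ->]]. rewrite lsum_app. simpl.
  assert (0 <= lsum f l1) by (apply lsum_nonneg; intros; apply Hf, in_or_app; now left).
  assert (0 <= lsum f l2) by (apply lsum_nonneg; intros; apply Hf, in_or_app; right; now right).
  lra.
Qed.

(** Finitely many series may be added termwise. If each of them reached its [m i], their sum would
    reach [lsum m J], which exceeds the dominating series. *)
Lemma series_pigeonhole {I} (J : list I) (m : I -> R) (u : I -> nat -> R) (v : nat -> R) :
  (forall i n, In i J -> 0 <= u i n) -> (forall n, lsum (fun i => u i n) J <= v n) ->
  ex_series v -> Series v < lsum m J ->
  exists i, In i J /\ ex_series (u i) /\ Series (u i) < m i.
Proof.
  intros Hu Huv Hv Hlt.
  assert (Hex : forall i, In i J -> ex_series (u i)).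
  { intros i Hi. apply ex_series_dominated with v; [|easy]. intros n. split; [auto|].
    eapply Rle_trans; [|apply Huv]. apply (lsum_ge_term (fun i => u i n)); [|easy]. auto. }
  apply NNPP. intros Hno. destruct (Series_lsum u J Hex) as [H1 H2].
  assert (H3 : lsum m J <= lsum (fun i => Series (u i)) J).
  { apply lsum_le. intros i Hi. apply Rnot_lt_le. intros h. apply Hno. exists i. auto. }
  rewrite <- H2 in H3.
  assert (H4 : Series (fun n => lsum (fun i => u i n) J) <= Series v); [|lra].
  apply Series_le; [|easy]. intros n. split; [apply lsum_nonneg; auto | apply Huv].
Qed.

Definition meets {d} (N : Rd d -> R) (C : Rd d -> Prop) (c : Rd d) (rho : R) : Prop :=
  exists y, C y /\ N (vsub y c) <= rho.

Definition if_prop (P : Prop) (a : R) : R := if excluded_middle_informative P then a else 0.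

(** Half the radius, because the limit point is only known to lie in closed balls while [F_t] asks
    for a strict inequality. *)
Definition shrunk (t rad : R) : R := Rpower rad t / 2.

Lemma shrunk_pos t rad : 0 < shrunk t rad.
Proof. unfold shrunk, Rpower. pose proof (exp_pos (t * ln rad)). lra. Qed.

Lemma shrunk_le t rad : 1 < t -> 0 < rad < 1 -> shrunk t rad <= rad / 2.
Proof.
  intros Ht Hr. unfold shrunk. assert (Rpower rad t <= rad); [|lra].
  rewrite <- (exp_ln rad) at 2 by lra. unfold Rpower. left. apply exp_increasing.
  pose proof (ln_increasing rad 1). rewrite ln_1 in H. nra.
Qed.

(** The power in the gauge turns [rad ^ t / 2] into [rad ^ d] up to the factor [2 ^ (d / t)], and
    the logarithm supplies a factor at least [A]. This is how any prescribed density can be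
    absorbed. *)
Lemma gauge_log_shrunk d t rad A : 1 < t -> 0 <= A -> 0 < rad < 1 -> rad <= exp (- A) ->
  rad ^ d * A <= Rpower 2 (INR d / t) * gauge_log d t (shrunk t rad).
Proof.
  intros Ht HA Hr HrA. pose proof (shrunk_pos t rad) as Hs.
  assert (E : ln (shrunk t rad) = t * ln rad - ln 2).
  { unfold shrunk. rewrite ln_div; [|apply exp_pos | lra]. now rewrite ln_Rpower. }
  assert (Hln : ln rad <= - A).
  { rewrite <- (ln_exp (- A)). destruct (Req_dec rad (exp (- A))) as [->|]; [lra|].
    left. apply ln_increasing; lra. }
  assert (Hln0 : ln rad < 0) by (pose proof (ln_increasing rad 1); rewrite ln_1 in *; lra).
  assert (Hln2 : 0 < ln 2) by (rewrite <- ln_1; apply ln_increasing; lra).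
  unfold gauge_log. destruct Rle_dec as [|_]; [lra|].
  rewrite <- Rmult_assoc. rewrite <- Rpower_pow by easy. unfold Rpower. rewrite E, <- exp_plus.
  replace (INR d / t * ln 2 + INR d / t * (t * ln rad - ln 2)) with (INR d * ln rad) by (field; lra).
  apply Rmult_le_compat_l; [left; apply exp_pos|].
  rewrite Rabs_left by nra. nra.
Qed.

Lemma lsum_if {I} (P : I -> Prop) (f : I -> R) J :
  lsum (fun i => if_prop (P i) (f i)) J
  = lsum f (filter (fun i => if excluded_middle_informative (P i) then true else false) J).
Proof.
  induction J as [|i J IH]; simpl; [easy|]. unfold if_prop at 1.
  destruct excluded_middle_informative; simpl; rewrite IH; ring.
Qed.

Lemma lsum_filter_le {I} (f : I -> R) p J : (forall i, In i J -> 0 <= f i) ->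
  lsum f (filter p J) <= lsum f J.
Proof.
  induction J as [|i J IH]; simpl; intros H; [lra|].
  assert (lsum f (filter p J) <= lsum f J) by (apply IH; auto).
  destruct (p i); simpl; [lra|]. specialize (H i (or_introl eq_refl)). lra.
Qed.

Lemma ForallOrdPairs_filter {A} (P : A -> A -> Prop) p l :
  ForallOrdPairs P l -> ForallOrdPairs P (filter p l).
Proof.
  intros H. induction H as [|a l Ha H IH]; simpl; [constructor|].
  destruct (p a); [|easy]. constructor; [|easy].
  rewrite Forall_forall in *. intros b Hb. apply Ha. now apply filter_In in Hb.
Qed.

(** [i0] is a partner for all later entries, and [i1] is one for [i0]. *)
Lemma separated_partner d I (N : Rd d -> R) (x : I -> Rd d) (r : I -> R) i0 i1 J :
  is_norm N -> separated N x r (i0 :: i1 :: J) ->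
  forall i, In i (i0 :: i1 :: J) ->
  exists j, In j (i0 :: i1 :: J) /\ r i + r j <= N (vsub (x i) (x j)).
Proof.
  intros HN Hsep i Hi. inversion Hsep as [|? ? HF _]; subst.
  rewrite Forall_forall in HF. destruct Hi as [<-|Hi].
  - exists i1. split; [right; now left|]. apply HF. now left.
  - exists i0. split; [now left|]. rewrite (norm_sym d N HN), Rplus_comm. now apply HF.
Qed.

(* The gauge is increasing up to this radius. *)
Definition r_max (d : nat) (t : R) : R := exp (- (t / INR d)).

Lemma r_max_lt_1 d t : (1 <= d)%nat -> 1 < t -> r_max d t < 1.
Proof.
  intros Hd Ht. assert (HD : 0 < INR d) by (apply lt_0_INR; lia).
  unfold r_max. rewrite <- exp_0. apply exp_increasing.
  assert (0 < t / INR d) by (apply Rdiv_lt_0_compat; lra). lra.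
Qed.

(** The minimum in the last clause treats both kinds of sets at once. For a set meeting a single
    small ball it is bounded by the cost, whatever the mass; for a set meeting several it is bounded
    by their masses, which are controlled by the packing bound or by [m]. *)
Lemma mass_subdivision d I (N : Rd d -> R) (x : I -> Rd d) (r : I -> R) (U : Rd d -> Prop) t :
  (1 <= d)%nat -> is_norm N -> homogeneous_ubiquitous N x r U -> 1 < t ->
  exists K, 1 <= K /\ forall c rho m, 0 < rho <= r_max d t -> 0 < m <= gauge_log d t rho ->
    (forall y, N (vsub y c) <= rho -> U y) ->
    exists (J : list I) (mass : I -> R),
      (forall i, In i J -> r i <= rho / 4 /\ N (vsub (x i) c) + r i <= rho /\
         0 < mass i <= gauge_log d t (shrunk t (r i))) /\
      lsum mass J = m /\
      forall C D, 0 < D <= r_max d t -> (forall y z, C y -> C z -> N (vsub y z) <= D) ->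
        lsum (fun i => if_prop (meets N C (x i) (shrunk t (r i)))
                         (Rmin (K * gauge_log d t D) (mass i))) J <= K * gauge_log d t D.
Proof.
  intros Hd HN HU Ht. pose proof (r_max_lt_1 d t Hd Ht) as Hmax.
  destruct (ubiquitous_selection d I N x r U HN HU) as [kap [Hkap Hsel]].
  destruct (separated_packing d N HN) as [Kp [HKp Hpack]].
  assert (Hr : forall i, 0 < r i) by apply HU.
  assert (HK : 0 < Kp * 3 ^ d / kap).
  { apply Rdiv_lt_0_compat; [apply Rmult_lt_0_compat; [easy | apply pow_lt; lra] | easy]. }
  (* The 1 settles sets with [D >= rho], for which [m <= gauge_log d t rho <= gauge_log d t D]; the
     other term comes from packing when [D < rho]. *)
  exists (1 + Kp * 3 ^ d / kap). split; [lra|]. set (K := 1 + Kp * 3 ^ d / kap).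
  intros c rho m Hrho Hm HB.
  assert (Hrd : 0 < rho ^ d) by (apply pow_lt; lra).
  set (P2 := Rpower 2 (INR d / t)). assert (HP2 : 0 < P2) by apply exp_pos.
  (* [mass i] is at most [m / (kap * rho ^ d) * r i ^ d], so radii below [exp (- A)] bring it under
     the gauge of the shrunk ball. *)
  set (A := P2 * m / (kap * rho ^ d)).
  assert (HA : 0 < A).
  { apply Rdiv_lt_0_compat; apply Rmult_lt_0_compat; lra. }
  destruct (Hsel c rho (Rmin (rho / 4) (exp (- A)))) as [J [Hsep [HJ Htot]]]; [lra | | easy |].
  { apply Rmin_glb_lt; [lra | apply exp_pos]. }
  set (tot := lsum (fun i => r i ^ d) J) in *.
  assert (Htot0 : 0 < kap * rho ^ d) by (apply Rmult_lt_0_compat; lra).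
  set (mass := fun i => m / tot * r i ^ d).
  assert (Hmt : 0 < m / tot) by (apply Rdiv_lt_0_compat; lra).
  assert (Hmass0 : forall i, 0 < mass i).
  { intros i. apply Rmult_lt_0_compat; [easy | now apply pow_lt]. }
  assert (Hmtot : m / tot <= m / (kap * rho ^ d)).
  { apply Rmult_le_compat_l; [lra|]. apply Rinv_le_contravar; lra. }
  assert (HJ4 : forall i, In i J -> r i <= rho / 4).
  { intros i Hi. destruct (HJ i Hi) as [H _]. eapply Rle_trans; [exact H | apply Rmin_l]. }
  assert (Hsum : lsum mass J = m).
  { unfold mass. rewrite lsum_scal. fold tot. field. lra. }
  exists J, mass. split; [|split; [exact Hsum|]].
  - intros i Hi. destruct (HJ i Hi) as [H1 H2]. specialize (HJ4 i Hi). specialize (Hr i).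
    split; [easy|]. split; [easy|]. split; [easy|].
    apply Rmult_le_reg_l with P2; [easy|].
    eapply Rle_trans; [|apply gauge_log_shrunk with (A := A); try lra].
    + unfold mass, A. fold P2. apply Rle_trans with (P2 * (m / (kap * rho ^ d) * r i ^ d)).
      * apply Rmult_le_compat_l; [lra|]. apply Rmult_le_compat_r; [apply pow_le; lra | easy].
      * right. field. lra.
    + eapply Rle_trans; [exact H1 | apply Rmin_r].
  - intros C D HD HC. rewrite lsum_if.
    set (p := fun i => if excluded_middle_informative (meets N C (x i) (shrunk t (r i)))
                       then true else false).
    assert (HgD : 0 < gauge_log d t D) by (apply gauge_log_pos; lra).
    assert (Hp : forall i, In i (filter p J) -> In i J /\ meets N C (x i) (shrunk t (r i))).
    { intros i Hi. apply filter_In in Hi. destruct Hi as [Hi Hpi]. split; [easy|].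
      unfold p in Hpi. now destruct excluded_middle_informative. }
    pose proof (ForallOrdPairs_filter _ p J Hsep) as HsepS.
    assert (HS : lsum mass (filter p J) <= m).
    { rewrite <- Hsum. apply lsum_filter_le. intros; left; apply Hmass0. }
    assert (HKg : 0 < K * gauge_log d t D) by (apply Rmult_lt_0_compat; unfold K; lra).
    destruct (filter p J) as [|i0 [|i1 S']] eqn:ES.
    + simpl. lra.
    + simpl. rewrite Rplus_0_r. apply Rmin_l.
    + rewrite <- ES in *. set (S := filter p J) in *.
      apply Rle_trans with (lsum mass S).
      { apply lsum_le. intros; apply Rmin_r. }
      destruct (Rle_dec rho D) as [HrD|HrD].
      * assert (gauge_log d t rho <= gauge_log d t D) by (apply gauge_log_mono; try easy; lra).
        unfold K in *. nra.
      * assert (Hpartner : forall i, In i S -> exists j, In j S /\ r i + r j <= N (vsub (x i) (x j))).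
        { rewrite ES in HsepS |- *. now apply separated_partner. }
        (* The set joins two shrunk balls, so [r i + r j <= r i / 2 + D + r j / 2]. *)
        assert (Hri : forall i, In i S -> r i <= 2 * D).
        { intros i Hi. destruct (Hpartner i Hi) as [j [Hj Hij]].
          destruct (Hp i Hi) as [HiJ [y [Hy1 Hy2]]]. destruct (Hp j Hj) as [HjJ [z [Hz1 Hz2]]].
          specialize (HC y z Hy1 Hz1).
          pose proof (norm_tri d N HN (x i) y (x j)) as T1.
          pose proof (norm_tri d N HN y z (x j)) as T2.
          rewrite (norm_sym d N HN (x i) y) in T1.
          pose proof (shrunk_le t (r i) Ht) as S1. pose proof (shrunk_le t (r j) Ht) as S2.
          pose proof (HJ4 i HiJ). pose proof (HJ4 j HjJ). pose proof (Hr i). pose proof (Hr j).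
          lra. }
        destruct (Hp i0) as [_ [y [Hy _]]]; [rewrite ES; now left|].
        assert (Hpk : lsum (fun i => r i ^ d) S <= Kp * (3 * D) ^ d).
        { apply Hpack with (x := x) (y := y); [easy | lra |].
          intros i Hi. specialize (Hri i Hi). destruct (Hp i Hi) as [HiJ [z [Hz1 Hz2]]].
          pose proof (Hr i). pose proof (HJ4 i HiJ). split; [lra|].
          pose proof (norm_tri d N HN (x i) z y) as T1. rewrite (norm_sym d N HN (x i) z) in T1.
          specialize (HC z y Hz1 Hy). pose proof (shrunk_le t (r i) Ht). lra. }
        unfold mass. rewrite lsum_scal.
        assert (HDd : 0 < D ^ d) by (apply pow_lt; lra).
        pose proof (gauge_log_ratio d t D rho Hd Ht) as Hratio.
        specialize (Hratio ltac:(lra) ltac:(lra)).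
        apply Rle_trans with (m / (kap * rho ^ d) * (Kp * (3 * D) ^ d)).
        { apply Rmult_le_compat; [lra | apply lsum_nonneg; intros; left; now apply pow_lt | easy | easy]. }
        rewrite Rpow_mult_distr.
        replace (m / (kap * rho ^ d) * (Kp * (3 ^ d * D ^ d)))
          with (Kp * 3 ^ d / kap * (m * D ^ d / rho ^ d)) by (field; lra).
        apply Rle_trans with (Kp * 3 ^ d / kap * gauge_log d t D).
        { apply Rmult_le_compat_l; [lra|]. apply Rmult_le_reg_r with (rho ^ d); [easy|].
          replace (m * D ^ d / rho ^ d * rho ^ d) with (m * D ^ d) by (field; lra).
          eapply Rle_trans; [|exact Hratio]. apply Rmult_le_compat_r; lra. }
        apply Rmult_le_compat_r; unfold K; lra.
Qed.

(** * The uncovered point *)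

(** Completeness of the reals is used in each coordinate: [sup_le_norm] makes the coordinates of the
    centres Cauchy, and [norm_le_sup] brings the limit back to the norm. *)
Lemma nested_balls_point d (N : Rd d -> R) (c : nat -> Rd d) (rho : nat -> R) :
  is_norm N -> (forall k, 0 < rho k) -> (forall e, 0 < e -> exists k, rho k <= e) ->
  (forall k, N (vsub (c (S k)) (c k)) + rho (S k) <= rho k) ->
  exists y, forall k, N (vsub y (c k)) <= rho k.
Proof.
  intros HN Hpos Hlim Hnest.
  destruct (norm_le_sup d N HN) as [b [Hb Hbs]].
  destruct (sup_le_norm d N HN) as [a [Ha Has]].
  assert (Hcc : forall k j, N (vsub (c (k + j)%nat) (c k)) + rho (k + j)%nat <= rho k).
  { intros k j. induction j as [|j IH].
    - rewrite Nat.add_0_r. rewrite vsub_diag.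
      rewrite (norm_at_0 d N HN). lra.
    - rewrite Nat.add_succ_r. specialize (Hnest (k + j)%nat).
      pose proof (norm_tri d N HN (c (S (k + j))) (c (k + j)%nat) (c k)). lra. }
  assert (Hco : forall k n i, (k <= n)%nat -> Rabs (c n i - c k i) <= rho k / a).
  { intros k n i Hn. specialize (Hcc k (n - k)%nat). replace (k + (n - k))%nat with n in Hcc by lia.
    specialize (Has (vsub (c n) (c k)) i). unfold vsub in Has at 1. specialize (Hpos n).
    apply Rmult_le_reg_l with a; [easy|]. replace (a * (rho k / a)) with (rho k) by (field; lra). lra. }
  assert (Hconv : forall i, exists l, Un_cv (fun n => c n i) l).
  { intros i. destruct (Rcomplete.R_complete (fun n => c n i)) as [l Hl]; [|now exists l].
    intros e He. destruct (Hlim (e * a / 4)) as [k Hk].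
    { apply Rdiv_lt_0_compat; [now apply Rmult_lt_0_compat | lra]. }
    assert (Hk' : rho k / a <= e / 4).
    { apply Rmult_le_reg_l with a; [easy|]. replace (a * (rho k / a)) with (rho k) by (field; lra). lra. }
    exists k. intros n m Hn Hm. unfold Rdist.
    pose proof (Hco k n i Hn) as H1. pose proof (Hco k m i Hm) as H2.
    apply Rabs_le_between in H1, H2. apply Rabs_lt_between. lra. }
  set (y := fun i => proj1_sig (constructive_indefinite_description _ (Hconv i))).
  assert (Hy : forall i, Un_cv (fun n => c n i) (y i))
    by (intros i; exact (proj2_sig (constructive_indefinite_description _ (Hconv i)))).
  assert (Hyc : forall k i, Rabs (y i - c k i) <= rho k / a).
  { intros k i. apply Rnot_lt_le. intros h.
    destruct (Hy i (Rabs (y i - c k i) - rho k / a)) as [n Hn]; [lra|].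
    specialize (Hn (Nat.max n k) (Nat.le_max_l _ _)). unfold Rdist in Hn.
    specialize (Hco k (Nat.max n k) i (Nat.le_max_r _ _)).
    rewrite Rabs_minus_sym in Hn.
    pose proof (Rabs_triang (y i - c (Nat.max n k) i) (c (Nat.max n k) i - c k i)) as T1.
    replace (y i - c (Nat.max n k) i + (c (Nat.max n k) i - c k i)) with (y i - c k i) in T1 by ring.
    lra. }
  exists y. intros k. apply Rnot_lt_le. intros h.
  (* With this radius, [y] is so close to a late centre [c n] that its distance to the ball around
     [c k] would be at most half of itself. *)
  destruct (Hlim ((N (vsub y (c k)) - rho k) * (a / (2 * b)))) as [j Hj].
  { apply Rmult_lt_0_compat; [lra | apply Rdiv_lt_0_compat; lra]. }
  assert (Hj' : exists n, (k <= n)%nat /\ rho n <= rho j).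
  { exists (k + j)%nat. split; [lia|]. specialize (Hcc j k). rewrite Nat.add_comm.
    assert (0 <= N (vsub (c (j + k)%nat) (c j))) by apply HN. lra. }
  destruct Hj' as [n [Hkn Hnj]].
  pose proof (norm_tri d N HN y (c n) (c k)) as T1.
  specialize (Hcc k (n - k)%nat). replace (k + (n - k))%nat with n in Hcc by lia.
  assert (T2 : N (vsub y (c n)) <= b * (rho n / a)).
  { apply Hbs; [left; now apply Rdiv_lt_0_compat|]. intros i. apply Hyc. }
  assert (T3 : b * (rho n / a) <= (N (vsub y (c k)) - rho k) / 2).
  { apply Rmult_le_reg_l with (a / b); [now apply Rdiv_lt_0_compat|].
    replace (a / b * (b * (rho n / a))) with (rho n) by (field; lra).
    eapply Rle_trans; [exact Hnj|]. eapply Rle_trans; [exact Hj|]. right. field. lra. }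
  specialize (Hpos n). lra.
Qed.

Lemma list_pos_min {I} (r : I -> R) (l : list I) : (forall i, 0 < r i) ->
  exists e, 0 < e /\ forall i, In i l -> e <= r i.
Proof.
  intros Hr. induction l as [|i l [e [He H]]]; [exists 1; split; [lra | easy]|].
  exists (Rmin e (r i)). split; [now apply Rmin_glb_lt|]. intros j [<-|Hj]; [apply Rmin_r|].
  eapply Rle_trans; [apply Rmin_l | now apply H].
Qed.

Lemma uncovered_point d I (N : Rd d -> R) (x : I -> Rd d) (r : I -> R) (U : Rd d -> Prop) t :
  (1 <= d)%nat -> is_norm N -> homogeneous_ubiquitous N x r U -> 1 < t ->
  exists K, 1 <= K /\ forall c0 rho0, 0 < rho0 <= r_max d t ->
    (forall y, N (vsub y c0) <= rho0 -> U y) ->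
    forall (C : nat -> Rd d -> Prop) (D : nat -> R),
      (forall n, 0 < D n <= r_max d t) ->
      (forall n y z, C n y -> C n z -> N (vsub y z) <= D n) ->
      ex_series (fun n => K * gauge_log d t (D n)) ->
      Series (fun n => K * gauge_log d t (D n)) < gauge_log d t rho0 ->
      exists y, U y /\ F_t N x r t y /\ forall n, ~ C n y.
Proof.
  intros Hd HN HU Ht.
  destruct (mass_subdivision d I N x r U t Hd HN HU Ht) as [K [HK Hsub]].
  exists K. split; [easy|]. intros c0 rho0 Hrho0 HB0 C D HD HC Hex Hlt.
  pose proof (r_max_lt_1 d t Hd Ht) as Hmax.
  assert (Hr : forall i, 0 < r i) by apply HU.
  set (cost := fun n => K * gauge_log d t (D n)) in *.
  assert (Hcost : forall n, 0 <= cost n).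
  { intros n. apply Rmult_le_pos; [lra | apply gauge_log_nonneg]. }
  set (alive := fun (c : Rd d) rho n => if_prop (meets N (C n) c rho) (cost n)).
  (* [m] is the mass of the current ball. Its bound by the gauge is what the next subdivision
     requires, and also what excludes in the end a set that meets all the balls. *)
  set (Inv := fun (c : Rd d) rho => 0 < rho <= r_max d t /\ (forall y, N (vsub y c) <= rho -> U y) /\
     exists m, 0 < m <= gauge_log d t rho /\ ex_series (alive c rho) /\ Series (alive c rho) < m).
  assert (Halive : forall c rho n, 0 <= alive c rho n <= cost n).
  { intros c rho n. unfold alive, if_prop. specialize (Hcost n).
    destruct excluded_middle_informative; lra. }
  assert (Hinit : Inv c0 rho0).
  { split; [easy|]. split; [easy|]. exists (gauge_log d t rho0). split.
    - split; [apply gauge_log_pos; lra | lra].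
    - assert (Series (alive c0 rho0) <= Series cost) by now apply Series_le.
      split; [|lra]. now apply ex_series_dominated with cost. }
  assert (Hstep : forall c rho, Inv c rho -> exists i, Inv (x i) (shrunk t (r i)) /\
            r i <= rho / 4 /\ N (vsub (x i) c) + r i <= rho).
  { intros c rho (Hrho & HB & m & Hm & Hexm & Hsm).
    destruct (Hsub c rho m Hrho Hm HB) as (J & mass & HJ & Hsum & Hmeet).
    set (u := fun i n => if_prop (meets N (C n) (x i) (shrunk t (r i))) (Rmin (cost n) (mass i))).
    assert (Hu0 : forall i n, In i J -> 0 <= u i n).
    { intros i n Hi. unfold u, if_prop. destruct excluded_middle_informative; [|lra].
      apply Rmin_glb; [apply Hcost | left; now apply HJ]. }
    assert (Hin : forall i, In i J -> forall y, N (vsub y (x i)) <= shrunk t (r i) -> N (vsub y c) <= rho).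
    { intros i Hi y Hy. destruct (HJ i Hi) as [H1 [H2 _]].
      pose proof (shrunk_le t (r i) Ht). pose proof (Hr i).
      pose proof (norm_tri d N HN y (x i) c). lra. }
    destruct (series_pigeonhole J mass u (alive c rho)) as [i [Hi [Hexi Hsi]]]; [easy | | easy | lra |].
    - intros n. unfold alive, if_prop at 1. destruct excluded_middle_informative as [h|h].
      + apply Hmeet; [apply HD | apply HC].
      (* A set missing the parent ball misses every shrunk ball inside it, so both sides are 0. *)
      + right. rewrite <- (Rmult_0_l (lsum mass J)), <- lsum_scal.
        apply Rle_antisym; apply lsum_le; intros i Hi; rewrite Rmult_0_l; [|now apply Hu0].
        unfold u, if_prop. destruct excluded_middle_informative as [h'|h']; [|lra].
        exfalso. apply h. destruct h' as [y [Hy1 Hy2]]. exists y. split; [easy|]. now apply (Hin i).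
    - exists i. destruct (HJ i Hi) as [H1 [H2 H3]]. split; [|easy].
      pose proof (Hr i) as Hri.
      (* Each truncated cost is at most the whole series, hence below [mass i], so every minimum
         equals the cost itself. *)
      assert (E : u i = alive (x i) (shrunk t (r i))).
      { apply functional_extensionality. intros n. unfold u, alive.
        assert (Hn : u i n <= Series (u i)) by (apply term_le_Series; auto).
        unfold u, if_prop in *. destruct excluded_middle_informative; [|easy].
        unfold Rmin in *. destruct Rle_dec; [easy | lra]. }
      split; [|split; [intros y Hy; apply HB; now apply (Hin i)|]].
      + split; [apply shrunk_pos|]. pose proof (shrunk_le t (r i) Ht). lra.
      + exists (mass i). rewrite <- E. easy. }
  (* Dependent choice: a state carries its proof of [Inv], which makes the step a function that can
     be iterated. *)
  set (state := {s : Rd d * R | Inv (fst s) (snd s)}).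
  set (ind := fun s : state => proj1_sig (constructive_indefinite_description _
                 (Hstep (fst (proj1_sig s)) (snd (proj1_sig s)) (proj2_sig s)))).
  assert (Hind : forall s : state, Inv (x (ind s)) (shrunk t (r (ind s))) /\
      r (ind s) <= snd (proj1_sig s) / 4 /\
      N (vsub (x (ind s)) (fst (proj1_sig s))) + r (ind s) <= snd (proj1_sig s))
    by (intros s; exact (proj2_sig (constructive_indefinite_description _
                 (Hstep (fst (proj1_sig s)) (snd (proj1_sig s)) (proj2_sig s))))).
  clearbody ind.
  set (next := fun s : state => exist (fun s => Inv (fst s) (snd s))
                 (x (ind s), shrunk t (r (ind s))) (proj1 (Hind s)) : state).
  set (st := fix st k : state := match k with
     | O => exist (fun s => Inv (fst s) (snd s)) (c0, rho0) Hinit | S k => next (st k) end).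
  set (c := fun k => fst (proj1_sig (st k))).
  set (rho := fun k => snd (proj1_sig (st k))).
  set (idx := fun k => ind (st k)).
  assert (HInv : forall k, Inv (c k) (rho k)) by (intros k; exact (proj2_sig (st k))).
  assert (Hc : forall k, c (S k) = x (idx k)) by reflexivity.
  assert (Hrho : forall k, rho (S k) = shrunk t (r (idx k))) by reflexivity.
  assert (Hidx : forall k, r (idx k) <= rho k / 4 /\ N (vsub (x (idx k)) (c k)) + r (idx k) <= rho k)
    by (intros k; exact (proj2 (Hind (st k)))).
  assert (Hrho00 : rho O = rho0) by reflexivity.
  assert (Hc00 : c O = c0) by reflexivity.
  clearbody c rho idx. clear Hind st next ind state.
  assert (Hpos : forall k, 0 < rho k <= r_max d t) by (intros k; apply HInv).
  assert (Hrs : forall k, rho (S k) <= r (idx k) / 2).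
  { intros k. rewrite Hrho. apply shrunk_le; [easy|]. specialize (Hidx k). specialize (Hpos k).
    specialize (Hr (idx k)). lra. }
  assert (Hpow : forall k, rho k <= (1 / 2) ^ k).
  { induction k as [|k IH]; [rewrite Hrho00; simpl; lra|]. simpl.
    specialize (Hrs k). specialize (Hidx k). specialize (Hpos k). lra. }
  assert (Hlim : forall e, 0 < e -> exists k, rho k <= e).
  { intros e He. destruct (pow_lt_1_zero (1 / 2)) with (y := e) as [k Hk]; [rewrite Rabs_right; lra | easy|].
    exists k. specialize (Hk k (le_n k)). apply Rabs_lt_between in Hk. specialize (Hpow k). lra. }
  destruct (nested_balls_point d N c rho HN) as [y Hy]; [apply Hpos | easy | |].
  { intros k. rewrite Hc. specialize (Hidx k). specialize (Hrs k). specialize (Hr (idx k)). lra. }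
  exists y. split; [|split].
  - apply HB0. rewrite <- Hc00, <- Hrho00. apply Hy.
  (* The radii over a finite list are bounded below, while the chosen ones are at most [rho k / 4]
     and become arbitrarily small. *)
  - intros [l Hl]. destruct (list_pos_min r l Hr) as [e [He Hle]].
    destruct (Hlim e He) as [k Hk]. assert (In (idx k) l).
    { apply Hl. specialize (Hy (S k)). rewrite Hc, Hrho in Hy.
      pose proof (shrunk_pos t (r (idx k))). unfold shrunk in *. lra. }
    specialize (Hle _ H). specialize (Hidx k). specialize (Hpos k). lra.
  (* A set containing [y] meets every ball, so its cost stays below [gauge_log d t (rho k)]. Since
     [K >= 1], this fails once [rho k <= D n]. *)
  - intros n Hn. destruct (Hlim (D n / 2)) as [k Hk]; [specialize (HD n); lra|].
    destruct (HInv k) as (_ & _ & m & Hm & Hexk & Hsk).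
    assert (H1 : alive (c k) (rho k) n <= Series (alive (c k) (rho k)))
      by (apply term_le_Series; [intros; apply Halive | easy]).
    unfold alive at 1, if_prop in H1. destruct excluded_middle_informative as [h|h].
    + assert (gauge_log d t (rho k) <= gauge_log d t (D n)).
      { apply gauge_log_mono; [easy | easy | | apply HD]. specialize (Hpos k). specialize (HD n). lra. }
      pose proof (gauge_log_nonneg d t (D n)). unfold cost in H1. nra.
    + apply h. exists y. split; [easy | apply Hy].
Qed.

(** * Positivity of the Hausdorff measures *)

Lemma open_contains_ball d (N : Rd d -> R) (U : Rd d -> Prop) c :
  is_norm N -> is_open U -> U c ->
  forall rho, 0 < rho -> exists rho', 0 < rho' <= rho /\ forall y, N (vsub y c) <= rho' -> U y.
Proof.
  intros HN HU Hc rho Hrho. destruct (HU c Hc) as [e [He HeU]].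
  destruct (sup_le_norm d N HN) as [a [Ha Has]].
  assert (Hae : 0 < a * e) by now apply Rmult_lt_0_compat.
  exists (Rmin rho (a * e / 2)). split; [split; [apply Rmin_glb_lt; lra | apply Rmin_l]|].
  intros y Hy. apply HeU. intros i. pose proof (Rmin_r rho (a * e / 2)).
  specialize (Has (vsub y c) i). unfold vsub in Has at 1.
  apply Rmult_lt_reg_l with a; lra.
Qed.

(** A ball of radius [rho] in [U] yields [delta = rho] and [c = gauge_log d t rho / K]: a cover
    whose partial sums stay below [c - eps] would miss a point of the set. *)
Lemma hausdorff_pos_gauge_log d I (N : Rd d -> R) (x : I -> Rd d) (r : I -> R) (U : Rd d -> Prop) t :
  (1 <= d)%nat -> is_norm N -> homogeneous_ubiquitous N x r U -> 1 < t ->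
  hausdorff_pos N (gauge_log d t) (fun y => F_t N x r t y /\ U y).
Proof.
  intros Hd HN HU Ht.
  destruct (uncovered_point d I N x r U t Hd HN HU Ht) as [K [HK Hpoint]].
  pose proof HU as (_ & [c0 Hc0] & Hopen & _).
  pose proof (r_max_lt_1 d t Hd Ht) as Hmax.
  destruct (open_contains_ball d N U c0 HN Hopen Hc0 (r_max d t)) as [rho [Hrho HB]];
    [apply exp_pos|].
  assert (Hg : 0 < gauge_log d t rho) by (apply gauge_log_pos; lra).
  exists rho, (gauge_log d t rho / K). split; [easy|]. split; [apply Rdiv_lt_0_compat; lra|].
  intros C D Hcov HD eps Heps. apply NNPP. intros Hno.
  assert (Hsum : forall M, sum_f_R0 (fun n => gauge_log d t (D n)) M <= gauge_log d t rho / K - eps).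
  { intros M. apply Rnot_gt_le. intros h. apply Hno. now exists M. }
  (* Sets of diameter 0 have no cost; they are given a small positive diameter. *)
  assert (HE : forall n, exists E, 0 < E <= r_max d t /\ D n <= E /\
            gauge_log d t E <= gauge_log d t (D n) + eps / 2 * (1 / 2) ^ S n).
  { intros n. destruct (HD n) as [[HD0 _] HDr].
    assert (He : 0 < eps / 2 * (1 / 2) ^ S n) by (apply Rmult_lt_0_compat; [lra | apply pow_lt; lra]).
    destruct (Rle_dec (D n) 0) as [h|h].
    - destruct (gauge_log_small d t _ rho Hd Ht He (proj1 Hrho)) as [E [HE1 HE2]].
      exists E. pose proof (gauge_log_nonneg d t (D n)). repeat split; lra.
    - exists (D n). repeat split; lra. }
  set (E := fun n => proj1_sig (constructive_indefinite_description _ (HE n))).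
  assert (HE' : forall n, 0 < E n <= r_max d t /\ D n <= E n /\
            gauge_log d t (E n) <= gauge_log d t (D n) + eps / 2 * (1 / 2) ^ S n)
    by (intros n; exact (proj2_sig (constructive_indefinite_description _ (HE n)))).
  clearbody E. clear HE.
  (* Replacing [D] by [E] costs at most half of the gap [eps]; the other half gives the strict
     inequality. *)
  destruct (ex_series_bounded (fun n => K * gauge_log d t (E n)) (gauge_log d t rho - K * (eps / 2)))
    as [Hex Hser].
  { intros n. apply Rmult_le_pos; [lra | apply gauge_log_nonneg]. }
  { intros M. rewrite (sum_eq _ (fun n => gauge_log d t (E n) * K)) by (intros; ring).
    rewrite <- scal_sum.
    assert (H : sum_f_R0 (fun n => gauge_log d t (E n)) M <= gauge_log d t rho / K - eps + eps / 2).
    { eapply Rle_trans; [apply sum_Rle; intros n _; apply HE'|]. rewrite sum_plus.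
      apply Rplus_le_compat; [apply Hsum | apply sum_geom_le; lra]. }
    apply Rmult_le_compat_l with (r := K) in H; [|lra].
    replace (K * (gauge_log d t rho / K - eps + eps / 2))
      with (gauge_log d t rho - K * (eps / 2)) in H by (field; lra). exact H. }
  destruct (Hpoint c0 rho Hrho HB C E) as [y [HyU [HyF HyC]]]; [apply HE' | | exact Hex | |].
  - intros n y z Hy Hz. destruct (HD n) as [[_ [H _]] _]. specialize (H y z Hy Hz).
    specialize (HE' n). lra.
  - assert (0 < K * (eps / 2)) by (apply Rmult_lt_0_compat; lra). lra.
  - destruct (Hcov y) as [n Hn]; [easy|]. now apply (HyC n).
Qed.

Lemma hausdorff_pos_mono d (N : Rd d -> R) g h E rho :
  0 < rho -> (forall D, D <= rho -> g D <= h D) ->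
  hausdorff_pos N g E -> hausdorff_pos N h E.
Proof.
  intros Hrho Hgh (delta & c & Hdelta & Hc & H).
  exists (Rmin delta rho), c. split; [now apply Rmin_glb_lt|]. split; [easy|].
  intros C D Hcov HD eps Heps. destruct (H C D Hcov) with (eps := eps) as [M HM]; [|easy|].
  - intros n. destruct (HD n) as [H1 H2]. split; [easy|].
    eapply Rle_trans; [exact H2 | apply Rmin_l].
  - exists M. eapply Rge_gt_trans; [|exact HM]. apply Rle_ge, sum_Rle. intros n _.
    apply Hgh. eapply Rle_trans; [apply HD | apply Rmin_r].
Qed.

Theorem theorem4p2 (d : nat) (Hd : (1 <= d)%nat)
  (N : Rd d -> R) (HN : is_norm N)
  (I : Type) (HI : countably_infinite I)
  (x : I -> Rd d) (r : I -> R) (U : Rd d -> Prop)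
  (HU : homogeneous_ubiquitous N x r U)
  (t : R) (Ht : 1 < t) :
  hausdorff_pos N (gauge_log d t) (fun y => F_t N x r t y /\ U y) /\
  (forall s, 0 < s < INR d / t ->
     hausdorff_pos N (gauge_pow s) (fun y => F_t N x r t y /\ U y)).
Proof.
  pose proof (hausdorff_pos_gauge_log d I N x r U t Hd HN HU Ht) as H.
  split; [exact H|]. intros s Hs.
  destruct (gauge_log_le_pow d t s Hs) as [rho [Hrho Hle]].
  exact (hausdorff_pos_mono d N _ _ _ rho Hrho Hle H).
Qed.
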